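(* Let $\mathcal{I}\subset\mathbb{R}$ be an open interval and let $\Phi:\mathcal{I}\to\mathbb{R}$ be smooth and convex. Let $(\mathbf{P}_t)_{t\geq0}$ be the M/M/$\infty$ semi-group with input rate $\lambda>0$ and service rate $\mu>0$, and let $\rho:=\lambda/\mu$. Then for any $f\in\mathcal{K}(\mathbb{N},\mathcal{I})$, the function $t\in[0,\infty)\mapsto\mathbf{Ent}_{\mathcal{P}(\rho)}^{\Phi}(\mathbf{P}_tf)$ is non-increasing. Moreover, when $A^\Phi$ is convex on $\mathcal{T}_{\mathcal{I}}$, for every $f\in\mathcal{K}(\mathbb{N},\mathcal{I})$ and $t\geq0$, $$\mathbf{Ent}_{\mathcal{P}(\rho)}^{\Phi}(\mathbf{P}_tf)\leq e^{-c\mu t}\,\mathbf{Ent}_{\mathcal{P}(\rho)}^{\Phi}(f)$$ for every constant $c$ (in particular for the best, i.e. largest, one) such that $$\forall g\in\mathrm{L}^{1,\Phi}(\mathcal{P}(\rho)),\quad c\,\mu\,\mathbf{Ent}_{\mathcal{P}(\rho)}^{\Phi}(g)\leq\lambda\,\mathbf{E}_{\mathcal{P}(\rho)}\big(B^\Phi(g,\mathrm{D}g)\big).$$ This last inequality holds with $c=1$ in general (i.e. whenever $A^\Phi$ is convex on $\mathcal{T}_{\mathcal{I}}$), and with $c=2$ when $\Phi(u)=u^2$ on $\mathcal{I}=\mathbb{R}$.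
   Context: $\mathbb{N}=\{0,1,2,\ldots\}$. The M/M/$\infty$ queue with input rate $\lambda$ and service rate $\mu$ is the continuous-time birth and death process on $\mathbb{N}$ with generator $\mathbf{L}f(n)=n\mu(f(n-1)-f(n))+\lambda(f(n+1)-f(n))$. Its Markov semi-group $\mathbf{P}_tf(n)=\mathbf{E}(f(X_t)\mid X_0=n)$ is explicitly given by: $\mathbf{P}_t(\cdot)(n)$ is the law $\mathcal{B}(n,p(t))*\mathcal{P}(\rho(1-p(t)))$ with $p(t)=e^{-\mu t}$, where $\mathcal{B}(n,p)=(p\delta_1+(1-p)\delta_0)^{*n}$ is the binomial law, $\mathcal{P}(\sigma)$ is the Poisson law of mean $\sigma$ (with $\mathcal{P}(0)=\delta_0$), and $*$ is convolution. $\mathcal{P}(\rho)$ is its reversible invariant law. $\mathcal{K}(\mathbb{N},\mathcal{I})$ is the set of functions $\mathbb{N}\to\mathcal{I}$ whose image is relatively compact in $\mathcal{I}$. $\mathbf{E}_Q$ is the mean under $Q$. $\mathrm{L}^{1,\Phi}(Q)$ is the set of functions $f\in\mathrm{L}^1(Q)$ with values in $\mathcal{I}$ such that $\Phi(f)\in\mathrm{L}^1(Q)$; $\mathbf{Ent}_Q^\Phi(f):=\mathbf{E}_Q(\Phi(f))-\Phi(\mathbf{E}_Qf)$. $\mathcal{T}_{\mathcal{I}}:=\{(u,v)\in\mathbb{R}^2: u\in\mathcal{I},\,u+v\in\mathcal{I}\}$; on $\mathcal{T}_{\mathcal{I}}$, $A^\Phi(u,v):=\Phi(u+v)-\Phi(u)-\Phi'(u)v$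 and $B^\Phi(u,v):=(\Phi'(u+v)-\Phi'(u))v$. $\mathrm{D}f(n):=f(n+1)-f(n)$, and $B^\Phi(f,\mathrm{D}f)$ is the non-negative function $n\mapsto B^\Phi(f(n),\mathrm{D}f(n))$, so that its mean is in $[0,+\infty]$. *)

(* Defs.v *)
From HB Require Import structures.
From mathcomp Require Import all_boot all_order all_algebra.
From mathcomp Require Import all_classical all_reals all_analysis.
From mathcomp Require Import measurable_realfun.

Set Implicit Arguments.
Unset Strict Implicit.
Unset Printing Implicit Defensive.

Import Order.TTheory GRing.Theory Num.Theory.
Import numFieldNormedType.Exports.

Local Open Scope classical_set_scope.
Local Open Scope ring_scope.

(* A function on an open interval I is represented by a total Phi : R -> R of
   which only the values on I are ever used; I being open, the iterated
   derivatives of Phi at the points of I only depend on Phi restricted to I. *)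
Definition smooth_on {R : realType} (I : set R) (Phi : R -> R) : Prop :=
  forall (n : nat) (x : R), I x -> derivable (derive1n n Phi) x 1.

(* closure A `&` I is the closure of A in the subspace I. *)
Definition relatively_compact_in {R : realType} (I A : set R) : Prop :=
  A `<=` I /\ compact (closure A `&` I).

Definition Kfun {R : realType} (I : set R) : set (nat -> R) :=
  [set f | relatively_compact_in I (range f)].

(* The second argument of poisson_prob is unused by the library, and
   poisson_prob 0 _ is the Dirac mass at 0. *)
Definition poisson_law {R : realType} (sigma : R) : probability nat R :=
  poisson_prob sigma 0.

Definition binomial_law {R : realType} (n : nat) (p : R) : probability nat R :=
  binomial_prob n p.

Definition addn_pair (x : nat * nat) : nat := (x.1 + x.2)%N.

Lemma measurable_addn_pair : measurable_fun [set: nat * nat] addn_pair.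
Proof. exact: measurable_fun_addn. Qed.

HB.instance Definition _ :=
  isMeasurableFun.Build _ _ _ _ addn_pair measurable_addn_pair.

Definition convolution {R : realType} (P Q : probability nat R) :
    probability nat R :=
  distribution (P \x Q)%E addn_pair.

(* Law of X_t given X_0 = n for the birth and death process on nat with generator
   L f n = n mu (f (n-1) - f n) + lambda (f (n+1) - f n): each of the n initial
   customers is still present with probability e^{-mu t}, independently of the
   newly arrived ones still present, whose number is Poisson. *)
Definition mminfty_law {R : realType} (lambda mu t : R) (n : nat) :
    probability nat R :=
  let p := expR (- (mu * t)) in
  convolution (binomial_law n p) (poisson_law (lambda / mu * (1 - p))).

Definition mminfty_semigroup {R : realType} (lambda mu t : R) (f : nat -> R) :
    nat -> R :=
  fun n => \int[mminfty_law lambda mu t n]_k f k.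

Definition L1Phi {R : realType} (I : set R) (Phi : R -> R)
    (Q : probability nat R) : set (nat -> R) :=
  [set f | [/\ Q.-integrable setT (EFin \o f), (forall n, I (f n)) &
               Q.-integrable setT (EFin \o (Phi \o f))]].

Definition Ent {R : realType} (Phi : R -> R) (Q : probability nat R)
    (f : nat -> R) : R :=
  \int[Q]_n Phi (f n) - Phi (\int[Q]_n f n).

(* R^o is R seen as a module over itself, as convex_function requires. *)
Definition T_set {R : realType} (I : set R) : set (R^o * R^o) :=
  [set x | I x.1 /\ I (x.1 + x.2)].

Definition A_transform {R : realType} (Phi : R -> R) (u v : R) : R :=
  Phi (u + v) - Phi u - derive1 Phi u * v.

Definition A_convex {R : realType} (I : set R) (Phi : R -> R) : Prop :=
  convex_function (T_set I : set (convex_lmodType (R^o * R^o)%type))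
    (fun x : R^o * R^o => A_transform Phi x.1 x.2).

Definition B_transform {R : realType} (Phi : R -> R) (u v : R) : R :=
  (derive1 Phi (u + v) - derive1 Phi u) * v.

Definition discrete_gradient {R : realType} (f : nat -> R) (n : nat) : R :=
  f n.+1 - f n.

(* The mean of B(g, Dg) is taken in [0, +oo]. *)
Definition B_entropic_inequality {R : realType} (I : set R) (Phi : R -> R)
    (lambda mu c : R) : Prop :=
  let Q := poisson_law (lambda / mu) in
  forall g : nat -> R, L1Phi I Phi Q g ->
    ((c * mu * Ent Phi Q g)%:E <=
     lambda%:E *
       \int[Q]_n (B_transform Phi (g n) (discrete_gradient g n))%:E)%E.

(* Main.v *)
Require Import Defs.
From HB Require Import structures.
From mathcomp Require Import all_boot all_order all_algebra.
From mathcomp Require Import all_classical all_reals all_analysis.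
From mathcomp Require Import lra.

Set Implicit Arguments.
Unset Strict Implicit.
Unset Printing Implicit Defensive.

Import Order.TTheory GRing.Theory Num.Theory.
Import numFieldNormedType.Exports.

Local Open Scope classical_set_scope.
Local Open Scope ring_scope.

(* Everything is done with partial sums of Poisson weights, so that no
   differentiation under an infinite sum is needed: derivatives of partial sums
   telescope up to a boundary term that vanishes in the limit.

   Dissipation. Let h_t = P_t f and let q be the weights of P(rho). Since
   h_t' = L h_t and mu (n+1) q_(n+1) = lambda q_n, the derivative of
   sum_(n <= N) q_n Phi(h_t(n)) is - lambda sum_(n < N) q_n B(h_t, D h_t)(n) plus
   the boundary term lambda q_N Phi'(h_t(N)) D h_t(N). With Phi = id this gives
   the invariance of P(rho); in general it makes e^(k t) Ent(P_t f) non-increasing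
   as soon as k Ent <= lambda E B (k = 0 is the first claim, k = c mu the second).

   Entropic inequality. Write E_s for the mean under P(s) and
   h_s(n) = E_(rho - s) g(n + .). Interpolating s |-> E_s Phi(h_s) between
   Phi(E g) and E Phi(g), the derivative is E_s A(h_s, D h_s), which by Jensen and
   the semigroup property (the case Phi = id of the same computation) is at most
   E_rho A(g, Dg). Hence Ent(g) <= rho E A(g, Dg), where A <= B in general and
   2 A = B for the square. Functions of L^(1,Phi) are reduced to bounded ones by
   stopping, n |-> g(min(n, k)), which can only decrease B(g, Dg). *)

(** * Poisson means of bounded sequences *)

Definition bounded_seq {R : realType} (g : nat -> R) : Prop :=
  exists M, forall n, `|g n| <= M.

Definition poisson_weight {R : realType} (s : R) (n : nat) : R :=
  s ^+ n / n`!%:R * expR (- s).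

(** Written as a power series in [s] times [e^(-s)]: for bounded [g] the series converges for every
    real [s], so that the mean can be differentiated termwise, at [s = 0] included. *)
Definition poisson_mean {R : realType} (s : R) (g : nat -> R) : R :=
  limn (pseries (fun n => g n / n`!%:R) s) * expR (- s).

Lemma cvg_seq_ext {R : realType} (u v : nat -> R) (l : R) :
  (forall n, u n = v n) -> u @ \oo --> l -> v @ \oo --> l.
Proof. by move=> /funext ->. Qed.

Lemma cvg_seq_unique {R : realType} (u : nat -> R) (a b : R) :
  u @ \oo --> a -> u @ \oo --> b -> a = b.
Proof. exact: (cvg_unique (@Rhausdorff R)). Qed.

Section bounded_seq.
Context {R : realType}.
Implicit Types g h : nat -> R.

Lemma bounded_seq_itv g (a b : R) : (forall n, a <= g n <= b) -> bounded_seq g.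
Proof.
move=> gab; exists (`|a| + `|b|) => n; rewrite ler_norml.
have /andP[ag gb] := gab n.
have := ler_norm b; have := ler_norm (- a); rewrite normrN.
have := normr_ge0 a; have := normr_ge0 b.
by move=> *; apply/andP; split; lra.
Qed.

Lemma bounded_seq_comp g (u : nat -> nat) :
  bounded_seq g -> bounded_seq (fun n => g (u n)).
Proof. by move=> [M gM]; exists M. Qed.

Lemma bounded_seq_cst (c : R) : bounded_seq (fun=> c).
Proof. by exists `|c|. Qed.

Lemma bounded_seqD g h :
  bounded_seq g -> bounded_seq h -> bounded_seq (fun n => g n + h n).
Proof.
move=> [M gM] [K hK]; exists (M + K) => n.
by apply: le_trans (ler_normD _ _) (lerD _ _).
Qed.

Lemma bounded_seqM g h :
  bounded_seq g -> bounded_seq h -> bounded_seq (fun n => g n * h n).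
Proof. by move=> [M gM] [K hK]; exists (M * K) => n; rewrite normrM ler_pM. Qed.

Lemma bounded_seqN g : bounded_seq g -> bounded_seq (fun n => - g n).
Proof. by move=> [M gM]; exists M => n; rewrite normrN. Qed.

Lemma bounded_seqB g h :
  bounded_seq g -> bounded_seq h -> bounded_seq (fun n => g n - h n).
Proof. by move=> bg bh; apply: bounded_seqD => //; exact: bounded_seqN. Qed.

Lemma bounded_discrete_gradient g :
  bounded_seq g -> bounded_seq (discrete_gradient g).
Proof. by move=> bg; apply: bounded_seqB => //; exact: bounded_seq_comp. Qed.

End bounded_seq.

(** * Derivatives of finite sums and products, and the mean value inequality *)

Section is_derive_fun.
Context {R : realType}.

Lemma is_derive_sum_nat (f : nat -> R -> R) (df : nat -> R) (x : R) (n : nat) :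
  (forall i, (i < n)%N -> is_derive x 1 (f i) (df i)) ->
  is_derive x 1 (fun y => \sum_(0 <= i < n) f i y) (\sum_(0 <= i < n) df i).
Proof.
elim: n => [|n IH] fdf.
  rewrite big_nil; under eq_fun do rewrite big_nil.
  exact: is_derive_cst.
rewrite big_nat_recr//=; under eq_fun do rewrite big_nat_recr//=.
apply: is_deriveD; last exact: fdf.
by apply: IH => i ?; apply: fdf; rewrite ltnS ltnW.
Qed.

Lemma is_deriveMr_fun (f g : R -> R) (x df dg : R) :
  is_derive x 1 f df -> is_derive x 1 g dg ->
  is_derive x 1 (fun y => f y * g y) (df * g x + f x * dg).
Proof.
move=> fdf gdg; apply: (is_derive_eq (is_deriveM fdf gdg)).
by rewrite /GRing.scale/= addrC; congr (_ + _); rewrite mulrC.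
Qed.

(** The mean value theorem as a one-sided bound. Interpolation and entropy decay both integrate
    their derivative estimates through it, [K] absorbing the boundary terms. *)
Lemma derive_le_increment (f df : R -> R) (a b K : R) : a <= b ->
  (forall x, a <= x <= b -> is_derive x 1 f (df x)) ->
  (forall x, a <= x <= b -> df x <= K) -> f b - f a <= K * (b - a).
Proof.
move=> ab fdf dfK.
have [||c cab ->] := @MVT_segment R f df a b ab.
- by move=> x; rewrite in_itv/= => /andP[ax xb]; apply: fdf; rewrite !ltW.
- apply: derivable_within_continuous => x; rewrite in_itv/= => xab.
  by have [] := fdf x xab.
- by apply: ler_wpM2r; [lra|apply: dfK; move: cab; rewrite in_itv].
Qed.

End is_derive_fun.

Section poisson_mean.
Context {R : realType}.
Implicit Types (g h : nat -> R) (s : R).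

(** Comparison with [M] times the exponential series at [|s|]. *)
Lemma is_cvg_bounded_pseries g s :
  bounded_seq g -> cvgn (pseries (fun n => g n / n`!%:R) s).
Proof.
move=> [M gM]; apply: normed_cvg; rewrite /normed_series_of /=.
have M0 : 0 <= M by apply: le_trans (gM 0%N).
apply: (@series_le_cvg _ _ (fun n => M * exp_coeff `|s| n)) => [n|n|n|].
- exact: normr_ge0.
- by rewrite mulr_ge0// exp_coeff_ge0.
- rewrite !normrM normfV normrX normr_nat /exp_coeff /=.
  rewrite -mulrA [X in _ * X]mulrC ler_wpM2r//.
- exact/is_cvg_seriesZ/is_cvg_series_exp_coeff.
Qed.

Lemma cvg_poisson_mean g s : bounded_seq g ->
  series (fun n => poisson_weight s n * g n) @ \oo --> poisson_mean s g.
Proof.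
move=> bg.
apply: (cvg_seq_ext _ (cvgMr_tmp (b := expR (- s))
  (@is_cvg_bounded_pseries _ s bg))) => n.
rewrite /pseries /series /= mulr_suml; apply: eq_bigr => k _.
by rewrite /poisson_weight; lra.
Qed.

Lemma poisson_weight_ge0 s n : 0 <= s -> 0 <= poisson_weight s n.
Proof. by move=> s0; rewrite !mulr_ge0 ?expR_ge0 ?invr_ge0// exprn_ge0. Qed.

Lemma poisson_weight0 n : poisson_weight 0 n = (n == 0%N)%:R :> R.
Proof.
rewrite /poisson_weight oppr0 expR0 mulr1 expr0n.
by case: n => [|n]; rewrite ?divr1 //= mul0r.
Qed.

(** For [s = lambda / mu] this is the detailed balance between arrivals at [n] and departures at
    [n + 1]. *)
Lemma poisson_weightS s n :
  n.+1%:R * poisson_weight s n.+1 = s * poisson_weight s n.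
Proof.
rewrite /poisson_weight exprS factS natrM invfM.
have : n.+1%:R * n.+1%:R^-1 = 1 :> R by rewrite divff.
set a := _%:R; set b := _^-1 => ab.
transitivity (a * b * (s * (s ^+ n / n`!%:R * expR (- s)))); first by lra.
by rewrite ab mul1r.
Qed.

Lemma poisson_mean_cst s c : poisson_mean s (fun=> c) = c.
Proof.
apply: (cvg_seq_unique (@cvg_poisson_mean _ s (bounded_seq_cst c))).
have cE : expR s * (c * expR (- s)) = c.
  by rewrite mulrCA expRxMexpNx_1 mulr1.
rewrite -[X in _ --> X]cE.
apply: (cvg_seq_ext _ (cvgMr_tmp (b := c * expR (- s))
  (@is_cvg_series_exp_coeff R s))) => n.
rewrite /series /= mulr_suml; apply: eq_bigr => k _.
by rewrite /poisson_weight /exp_coeff /=; lra.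
Qed.

Lemma poisson_meanD s g h : bounded_seq g -> bounded_seq h ->
  poisson_mean s (fun n => g n + h n) = poisson_mean s g + poisson_mean s h.
Proof.
move=> bg bh; apply: (cvg_seq_unique).
  exact/cvg_poisson_mean/bounded_seqD.
apply: (cvg_seq_ext _ (cvgD (@cvg_poisson_mean _ s bg)
  (@cvg_poisson_mean _ s bh))) => n.
rewrite [LHS]/+%R /= /series /= -big_split/=; apply: eq_bigr => k _.
by rewrite mulrDr.
Qed.

Lemma poisson_meanZ s c g : bounded_seq g ->
  poisson_mean s (fun n => c * g n) = c * poisson_mean s g.
Proof.
move=> bg; apply: (cvg_seq_unique).
  by apply/cvg_poisson_mean/bounded_seqM => //; exact: bounded_seq_cst.
apply: (cvg_seq_ext _ (cvgMl_tmp (a := c) (@cvg_poisson_mean _ s bg))) => n.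
rewrite /series /= mulr_sumr; apply: eq_bigr => k _.
by rewrite mulrCA.
Qed.

Lemma poisson_meanN s g : bounded_seq g ->
  poisson_mean s (fun n => - g n) = - poisson_mean s g.
Proof.
move=> bg; rewrite -mulN1r -poisson_meanZ//; congr poisson_mean.
by apply/funext => n; rewrite mulN1r.
Qed.

Lemma poisson_meanB s g h : bounded_seq g -> bounded_seq h ->
  poisson_mean s (fun n => g n - h n) = poisson_mean s g - poisson_mean s h.
Proof.
by move=> bg bh; rewrite poisson_meanD ?poisson_meanN//; exact: bounded_seqN.
Qed.

Lemma poisson_mean_le s g h : 0 <= s -> bounded_seq g -> bounded_seq h ->
  (forall n, g n <= h n) -> poisson_mean s g <= poisson_mean s h.
Proof.
move=> s0 bg bh gh.
apply: (ler_cvg_to (@cvg_poisson_mean _ s bg) (@cvg_poisson_mean _ s bh)).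
near=> n; apply: ler_sum => k _.
by rewrite ler_wpM2l// poisson_weight_ge0.
Unshelve. all: by end_near. Qed.

Lemma poisson_mean_itv s g a b : 0 <= s -> (forall n, a <= g n <= b) ->
  a <= poisson_mean s g <= b.
Proof.
move=> s0 gab; have bg := bounded_seq_itv gab.
apply/andP; split.
- rewrite -[leLHS](poisson_mean_cst s a); apply: poisson_mean_le => //.
    exact: bounded_seq_cst.
  by move=> n; have /andP[] := gab n.
- rewrite -[leRHS](poisson_mean_cst s b); apply: poisson_mean_le => //.
    exact: bounded_seq_cst.
  by move=> n; have /andP[] := gab n.
Qed.

Lemma le_poisson_mean s g N : 0 <= s -> bounded_seq g ->
  (forall n, 0 <= g n) ->
  \sum_(0 <= n < N) poisson_weight s n * g n <= poisson_mean s g.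
Proof.
move=> s0 bg g0.
have cg := @cvg_poisson_mean _ s bg.
rewrite -(cvg_lim _ cg)//; apply: nondecreasing_cvgn_le.
- apply/nondecreasing_seqP => n; rewrite /series /= big_nat_recr//= lerDl.
  by rewrite mulr_ge0// poisson_weight_ge0.
- by apply/cvg_ex; exists (poisson_mean s g).
Qed.

Lemma poisson_mean0 g : bounded_seq g -> poisson_mean 0 g = g 0%N.
Proof.
move=> bg; apply: (cvg_seq_unique (@cvg_poisson_mean _ 0 bg)).
rewrite -(@cvg_shiftS _ (series _)).
apply: cvg_near_cst; near=> n; rewrite /series/= big_nat_recl//= big1 ?addr0.
  by rewrite poisson_weight0 mul1r.
by move=> i _; rewrite poisson_weight0 mul0r.
Unshelve. all: by end_near. Qed.

(** Differentiating the series shifts [g] by one, differentiating [e^(-s)] subtracts the unshifted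
    mean; the difference is the mean of the gradient. *)
Lemma is_derive_poisson_mean g s : bounded_seq g ->
  is_derive s 1 (fun x => poisson_mean x g)
    (poisson_mean s (discrete_gradient g)).
Proof.
move=> bg.
have diffsE (h : nat -> R) : pseries_diffs (fun n => h n / n`!%:R) =
    (fun n => h n.+1 / n`!%:R).
  by apply/funext => n; rewrite /pseries_diffs factS natrM invfM mulrCA mulVKf.
have bgS : bounded_seq (fun n => g n.+1) by exact: bounded_seq_comp.
have bgSS : bounded_seq (fun n => g n.+2).
  exact: (bounded_seq_comp (fun n => n.+2)).
have D : is_derive s 1 (fun x => limn (pseries (fun n => g n / n`!%:R) x))
   (limn (pseries (fun n => g n.+1 / n`!%:R) s)).
  (* Any point of modulus larger than [|s|] would do: the series converges everywhere. *)
  rewrite -diffsE; apply: (@pseries_snd_diffs _ _ (`|s| + 1)).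
  - exact: is_cvg_bounded_pseries.
  - by rewrite diffsE; exact: is_cvg_bounded_pseries.
  - rewrite diffsE (diffsE (fun n => g n.+1)).
    exact: is_cvg_bounded_pseries.
  - by rewrite (ger0_norm (addr_ge0 (normr_ge0 s) ler01)) ltrDl.
have E : is_derive s 1 (fun x => expR (- x)) (- expR (- s)).
  apply: (is_derive_eq (@is_derive1_comp R expR -%R s _ _ _ _)).
  by rewrite mulrN1.
apply: (is_derive_eq (is_deriveMr_fun D E)).
by rewrite /discrete_gradient poisson_meanB// /poisson_mean; lra.
Qed.

(** The forward equation of the Poisson process, with weight 0 at index -1. *)
Lemma is_derive_poisson_weight s n :
  is_derive s 1 (fun x => poisson_weight x n)
    ((if n is k.+1 then poisson_weight s k else 0) - poisson_weight s n).
Proof.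
have E : is_derive s 1 (fun x => expR (- x)) (- expR (- s)).
  apply: (is_derive_eq (@is_derive1_comp R expR -%R s _ _ _ _)).
  by rewrite mulrN1.
have D : is_derive s 1 (fun x : R => x ^+ n / n`!%:R)
    (n%:R * s ^+ n.-1 / n`!%:R).
  have -> : (fun x : R => x ^+ n / n`!%:R) = (fun x => (id ^+ n) x / n`!%:R).
    by apply/funext => x; rewrite exprfctE.
  apply: (is_derive_eq (is_deriveMr_fun (is_deriveX n (is_derive_id s 1))
     (is_derive_cst (n`!%:R^-1 : R) s 1))).
  by rewrite mulr0 addr0 /GRing.scale/= mulr1 mulr_natl.
apply: (is_derive_eq (is_deriveMr_fun D E)).
case: n {D} => [|n]; rewrite /poisson_weight.
  by rewrite !mul0r; lra.
rewrite mulrN; congr (_ * _ - _).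
by rewrite factS natrM invfM mulrACA divff ?mul1r.
Qed.

End poisson_mean.

(** * Integrals under Poisson, binomial and M/M/oo laws *)

Section discrete_integral.
Context {R : realType} (P : probability nat R).
Implicit Types f g : nat -> R.

Lemma integrable_bounded_seq f :
  bounded_seq f -> P.-integrable setT (EFin \o f).
Proof.
move=> [M fM]; apply: measurable_bounded_integrable => //.
  by rewrite (le_lt_trans (probability_le1 _ _)) ?ltry.
exists M; split; first exact: num_real.
by move=> x Mx n _ /=; exact: le_trans (fM n) (ltW Mx).
Qed.

(** Dominated convergence for the truncations of [f] to [I_n], with dominating function [|f|]. *)
Lemma cvg_sum_integral f : P.-integrable setT (EFin \o f) ->
  series (fun n => fine (P [set n]) * f n) @ \oo --> \int[P]_n f n.
Proof.
move=> intf; rewrite /Rintegral.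
have finf : (\int[P]_n (f n)%:E)%E \is a fin_num by exact: integrable_fin_num.
have H : (\int[P]_k ((EFin \o f) \_ `I_n) k)%E @[n --> \oo] -->
    (\int[P]_n (f n)%:E)%E.
  apply: (@dominated_cvg _ _ _ P setT _ _ _ (fun n => `|(f n)%:E|)%E) => //.
  - move=> k _; apply: cvg_near_cst; near=> n.
    rewrite /patch mem_set//=; near: n; by exists k.+1.
  - exact: (integrable_abse intf).
  - move=> n k _; rewrite /patch; case: ifPn => //= _.
    by rewrite normr0 lee_fin.
have sumE n : (\int[P]_(k in `I_n) (f k)%:E)%E =
    (series (fun n => fine (P [set n]) * f n) n)%:E.
  elim: n => [|n IH]; first by rewrite II0 integral_set0 /series/= big_nil.
  rewrite IIS integral_setU//=; last first.
    by apply/disj_setPS => k /= [kn kE]; rewrite kE ltnn in kn.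
  rewrite IH /series/= big_nat_recr//= EFinD; congr (_ + _)%E.
  rewrite (eq_integral (cst (f n)%:E)); last by move=> k /[!inE] ->.
  by rewrite integral_cst// muleC EFinM fineK// fin_num_measure.
move: H; rewrite -{1}(fineK finf) => /fine_cvg; apply: cvg_seq_ext => n /=.
by rewrite -integral_mkcond sumE.
Unshelve. all: by end_near. Qed.

End discrete_integral.

Section poisson_integral.
Context {R : realType}.
Implicit Types f g : nat -> R.

Lemma poisson_law_set1 (s : R) n : 0 <= s ->
  fine (poisson_law s [set n]) = poisson_weight s n.
Proof.
have -> : poisson_law s [set n] =
    if 0 < s then (\esum_(k in [set n]) (poisson_pmf s k)%:E)%E
    else \d_0%N [set n] by [].
(* For [s = 0] the law is a Dirac mass by definition, hence the separate case. *)
rewrite le_eqVlt => /predU1P[<-|s0].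
  by rewrite ltxx diracE poisson_weight0 in_set1 eq_sym.
by rewrite s0 esum_set1 ?lee_fin ?poisson_pmf_ge0//= /poisson_pmf s0.
Qed.

Lemma cvg_poisson_integral (s : R) f : 0 <= s ->
  (poisson_law s).-integrable setT (EFin \o f) ->
  series (fun n => poisson_weight s n * f n) @ \oo -->
    \int[poisson_law s]_n f n.
Proof.
move=> s0 /cvg_sum_integral; apply: cvg_seq_ext => n.
by apply: eq_bigr => k _; rewrite poisson_law_set1.
Qed.

Lemma Rintegral_poisson (s : R) f : 0 <= s -> bounded_seq f ->
  \int[poisson_law s]_n f n = poisson_mean s f.
Proof.
move=> s0 bf; apply: cvg_seq_unique (@cvg_poisson_mean _ _ s bf).
exact/cvg_poisson_integral/integrable_bounded_seq.
Qed.

Lemma integral_poisson (s : R) f : 0 <= s -> bounded_seq f ->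
  (\int[poisson_law s]_n (f n)%:E)%E = (poisson_mean s f)%:E.
Proof.
move=> s0 bf; rewrite -Rintegral_poisson// /Rintegral fineK//.
exact/integrable_fin_num/integrable_bounded_seq.
Qed.

Lemma binomial_law_set1 (n : nat) (p : R) k : 0 <= p <= 1 ->
  fine (binomial_law n p [set k]) = binomial_pmf n p k.
Proof.
have -> : binomial_law n p [set k] =
    if 0 <= p <= 1 then (\esum_(k in [set k]) (binomial_pmf n p k)%:E)%E
    else \d_0%N [set k] by [].
by move=> p01; rewrite p01 esum_set1//= lee_fin binomial_pmf_ge0.
Qed.

Lemma Rintegral_binomial (n : nat) (p : R) f : 0 <= p <= 1 -> bounded_seq f ->
  \int[binomial_law n p]_k f k =
  \sum_(0 <= k < n.+1) binomial_pmf n p k * f k.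
Proof.
move=> p01 bf.
have := cvg_sum_integral (integrable_bounded_seq (binomial_law n p) bf).
move/cvg_seq_unique; apply; apply: cvg_near_cst; near=> m.
have nm : (n < m)%N by near: m; exists n.+1.
rewrite /series/= (@big_cat_nat _ _ _ n.+1)//= [X in _ + X]big_nat
  [X in _ + X]big1 ?addr0.
  apply: eq_big_nat => k /andP[_ kn]; congr (_ * _).
  exact: binomial_law_set1.
move=> k /andP[nk _]; rewrite [fine _](binomial_law_set1 n k p01).
by rewrite /binomial_pmf bin_small// mulr0n mul0r.
Unshelve. all: by end_near. Qed.

(* Pascal's rule, that is, conditioning on the fate of the last customer. *)
Lemma sum_binomial_pmfS (n : nat) (p : R) f :
  \sum_(0 <= k < n.+2) binomial_pmf n.+1 p k * f k =
  (1 - p) * (\sum_(0 <= k < n.+1) binomial_pmf n p k * f k) +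
  p * (\sum_(0 <= k < n.+1) binomial_pmf n p k * f k.+1).
Proof.
have pmf0 : binomial_pmf n.+1 p 0 = (1 - p) * binomial_pmf n p 0.
  by rewrite /binomial_pmf !bin0 !mulr1n !subn0 !expr0 !mul1r exprS.
have pmfS k : (k < n.+1)%N -> binomial_pmf n.+1 p k.+1 =
    (1 - p) * binomial_pmf n p k.+1 + p * binomial_pmf n p k.
  rewrite ltnS => kn; rewrite /binomial_pmf binS mulrnDr; congr (_ + _).
    move: kn; rewrite leq_eqVlt => /predU1P[->|kn].
      by rewrite bin_small// !mulr0n mulr0.
    by rewrite subSS -(subnSK kn) mulrnAr mulrCA -exprS.
  by rewrite subSS mulrnAr exprS mulrA.
have pmf_last : binomial_pmf n p n.+1 = 0.
  by rewrite /binomial_pmf bin_small// mulr0n.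
rewrite big_nat_recl//= pmf0.
under eq_big_nat => k /= kn do rewrite pmfS// mulrDl.
rewrite big_split/= addrA; congr (_ + _); last first.
  by rewrite mulr_sumr; apply: eq_bigr => k _; rewrite mulrA.
rewrite mulr_sumr [in RHS]big_nat_recl//= mulrA; congr (_ + _).
rewrite big_nat_recr//= pmf_last mulr0 mul0r addr0.
by apply: eq_bigr => k _; rewrite mulrA.
Qed.

End poisson_integral.

(** The semigroup with [p = e^(-mu t)], by recursion on the initial customers: each has left with
    probability [1 - p], or is still present and shifts [f] by one. The base case is the Poisson
    number of new arrivals. Properties of the semigroup become inductions on [n]. *)
Fixpoint mminfty_mean {R : realType} (rho p : R) (f : nat -> R) (n : nat) : R :=
  if n is m.+1 then
    (1 - p) * mminfty_mean rho p f m +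
    p * mminfty_mean rho p (fun k => f k.+1) m
  else poisson_mean (rho * (1 - p)) f.

Section mminfty_mean.
Context {R : realType}.
Implicit Types (f : nat -> R) (p rho : R).

Lemma sum_binomial_poisson rho p f n :
  \sum_(0 <= k < n.+1)
    binomial_pmf n p k * poisson_mean (rho * (1 - p)) (fun j => f (k + j)%N) =
  mminfty_mean rho p f n.
Proof.
elim: n f => [|n IH] f.
  rewrite big_nat1 /binomial_pmf bin0 mulr1n !expr0 !mul1r /=.
  by congr poisson_mean; apply/funext => j; rewrite add0n.
rewrite sum_binomial_pmfS IH /=; congr (_ + _ * _).
exact: (IH (fun k => f k.+1)).
Qed.

(** Transfer along the addition map, then Fubini: the inner integral is a Poisson mean over the
    arrivals, the outer one a binomial sum over the survivors. *)
Lemma mminfty_semigroupE (lambda mu t : R) f : 0 < lambda -> 0 < mu -> 0 <= t ->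
  bounded_seq f -> mminfty_semigroup lambda mu t f =
    mminfty_mean (lambda / mu) (expR (- (mu * t))) f.
Proof.
move=> lambda0 mu0 t0 bf; apply/funext => n.
rewrite /mminfty_semigroup /mminfty_law.
set p := expR _; set rho := lambda / mu.
have p01 : 0 <= p <= 1.
  by rewrite expR_ge0 -expR0 ler_expR oppr_le0 mulr_ge0// ltW.
have s0 : 0 <= rho * (1 - p).
  apply: mulr_ge0; first by rewrite divr_ge0 ?ltW.
  by rewrite subr_ge0; case/andP: p01.
set B := binomial_law n p; set P := poisson_law _.
have bfk k : bounded_seq (fun j => f (k + j)%N).
  exact: (bounded_seq_comp (fun j => k + j)%N).
have intf : (B \x P)%E.-integrable setT (EFin \o (f \o addn_pair)).
  case: bf => [M fM].
  apply: measurable_bounded_integrable => //.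
  - by rewrite (le_lt_trans (probability_le1 _ _)) ?ltry.
  - apply: (@measurableT_comp _ _ _ _ _ _ f) => //.
  - exists M; split; first exact: num_real.
    by move=> x Mx k _ /=; exact: le_trans (fM _) (ltW Mx).
rewrite /Rintegral /convolution integral_distribution//=.
rewrite -integral12_prod_meas1//= /fubini_F/=.
have -> : (fun k => \int[P]_j (f (addn_pair (k, j)))%:E)%E =
    (fun k => (poisson_mean (rho * (1 - p)) (fun j => f (k + j)%N))%:E).
  apply/funext => k; exact: (integral_poisson s0 (bfk k)).
rewrite -[LHS]/(\int[B]_k
  (poisson_mean (rho * (1 - p)) (fun j => f (k + j)%N))).
rewrite Rintegral_binomial//; first exact: sum_binomial_poisson.
case: bf => [M fM]; apply: (@bounded_seq_itv _ _ (- M) M) => k.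
by apply: poisson_mean_itv => // j; rewrite -ler_norml.
Qed.

End mminfty_mean.

(** * Tangent inequalities *)

Section tangent.
Context {R : realType}.
Implicit Types (I : set R) (Phi : R -> R).

(** The difference quotients at 0 from the right are at most [c], and so is their limit. *)
Lemma derive_le_chord (phi : R -> R) (d c : R) :
  (forall t, 0 < t < 1 -> phi t <= phi 0 + t * c) ->
  is_derive (0 : R) 1 phi d -> d <= c.
Proof.
move=> chord [dphi <-].
have /cvg_dnbhs_at_right H := dphi.
apply: (cvgr_to_le H); near=> h.
have h01 : 0 < h < 1.
  by apply/andP; split; near: h; [exact: nbhs_right_gt|exact: nbhs_right_lt].
have /andP[h0 _] := h01.
rewrite /= addr0 /GRing.scale/= mulr1 mulrC ler_pdivrMr//.
by rewrite lerBlDl mulrC; exact: chord.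
Unshelve. all: by end_near. Qed.

Lemma is_derive_line_comp (f : R -> R) (df a v : R) :
  is_derive a 1 f df ->
  is_derive (0 : R) 1 (fun t => f (a + t * v)) (df * v).
Proof.
move=> fdf.
have line : is_derive (0 : R) 1 (fun t => a + t * v) v.
  apply: (is_derive_eq (is_deriveD (is_derive_cst a (0 : R) 1)
    (is_deriveMr_fun (is_derive_id (0 : R) 1) (is_derive_cst v (0 : R) 1)))).
  by rewrite add0r mul1r mul0r addr0.
apply: (@is_derive1_comp _ f (fun t => a + t * v)) => //.
by rewrite mul0r addr0.
Qed.

(** On the segment from [x] to [y], convexity puts the graph below the chord, so the slope at [x] is
    at most that of the chord. *)
Lemma convex_tangent I Phi (x y : R) :
  convex_function (I : set (convex_lmodType R^o)) Phi ->
  derivable Phi x 1 -> I x -> I y ->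
  Phi x + derive1 Phi x * (y - x) <= Phi y.
Proof.
move=> cPhi dPhi Ix Iy; rewrite -lerBrDl.
have D := is_derive_line_comp (y - x) (DeriveDef dPhi (esym (derive1E Phi x))).
apply: (derive_le_chord _ D) => t /andP[t0 t1].
have := cPhi (Itv01 (ltW t0) (ltW t1)) y x (mem_set Iy) (mem_set Ix).
rewrite mul0r addr0 /conv/= /GRing.scale/= /unstable.onem.
have -> : t * y + (1 - t) * x = x + t * (y - x) by lra.
by rewrite [X in _ <= X]convRE /unstable.onem/= => H; apply: le_trans H _; lra.
Qed.

(** The same chord argument on a segment of the plane gives a supporting plane of [A_transform] at
    [(u, v)], the form of convexity that Jensen's inequality needs. *)
Lemma A_convex_tangent I Phi (u v : R) :
  A_convex I Phi ->
  derivable Phi u 1 -> derivable Phi (u + v) 1 -> derivable (derive1 Phi) u 1 ->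
  I u -> I (u + v) ->
  exists a b, forall u' v', I u' -> I (u' + v') ->
    A_transform Phi u v + a * (u' - u) + b * (v' - v) <= A_transform Phi u' v'.
Proof.
move=> cA dPhi dPhiuv ddPhi Iu Iuv.
(* The witnesses are the partial derivatives of [A_transform] in [u] and in [v]. *)
exists (derive1 Phi (u + v) - derive1 Phi u - derive1 (derive1 Phi) u * v).
exists (derive1 Phi (u + v) - derive1 Phi u) => u' v' Iu' Iuv'.
rewrite -addrA -lerBrDl.
have Du := is_derive_line_comp (u' - u) (DeriveDef dPhi (esym (derive1E Phi u))).
have Duv := is_derive_line_comp (u' + v' - (u + v))
  (DeriveDef dPhiuv (esym (derive1E Phi (u + v)))).
have DDu := is_derive_line_comp (u' - u)
  (DeriveDef ddPhi (esym (derive1E (derive1 Phi) u))).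
have Dv := is_derive_line_comp (v' - v) (is_derive_id v (1 : R)).
pose phi t := A_transform Phi (u + t * (u' - u)) (v + t * (v' - v)).
apply: (@derive_le_chord phi) => [t /andP[t0 t1]|].
  have := cA (Itv01 (ltW t0) (ltW t1)) (u', v') (u, v).
  rewrite !inE => /(_ (conj Iu' Iuv') (conj Iu Iuv)).
  rewrite /phi !mul0r !addr0 /conv/= /GRing.scale/= /unstable.onem.
  have -> : t * u' + (1 - t) * u = u + t * (u' - u) by lra.
  have -> : t * v' + (1 - t) * v = v + t * (v' - v) by lra.
  rewrite [X in _ <= X]convRE /unstable.onem/= => H; apply: le_trans H _; lra.
have -> : phi = (fun t => Phi (u + v + t * (u' + v' - (u + v))) -
    Phi (u + t * (u' - u)) - derive1 Phi (u + t * (u' - u)) * (v + t * (v' - v))).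
  apply/funext => t; rewrite /phi /A_transform; congr (Phi _ - _ - _); lra.
apply: (is_derive_eq (is_deriveB (is_deriveB Duv Du) (is_deriveMr_fun DDu Dv))).
by rewrite !mul0r !addr0; lra.
Qed.

End tangent.

(** The sequences [M - g] and [M + g] are nonnegative, so their partial sums stay below their means.
    The bound depends on [g] only through [M], which makes the later error terms uniform in time. *)
Lemma poisson_mean_tail {R : realType} (s M : R) (g : nat -> R) (N : nat) :
  0 <= s -> (forall n, `|g n| <= M) ->
  `|poisson_mean s g - \sum_(0 <= n < N) poisson_weight s n * g n| <=
  M * (1 - \sum_(0 <= n < N) poisson_weight s n).
Proof.
move=> s0 gM.
have bg : bounded_seq g by exists M.
have bM := bounded_seq_cst M : bounded_seq _.
have sumC : \sum_(0 <= n < N) poisson_weight s n * M =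
    M * \sum_(0 <= n < N) poisson_weight s n.
  by rewrite mulr_sumr; apply: eq_bigr => n _; rewrite mulrC.
have := @le_poisson_mean _ s (fun n => M - g n) N s0 (bounded_seqB bM bg).
have := @le_poisson_mean _ s (fun n => M + g n) N s0 (bounded_seqD bM bg).
rewrite poisson_meanB// poisson_meanD// poisson_mean_cst.
under eq_bigr do rewrite mulrDr.
under [X in _ -> (_ -> X <= _) -> _]eq_bigr do rewrite mulrBr.
rewrite sumrB big_split/= sumC ler_norml => H1 H2.
have H n : - M <= g n <= M by rewrite -ler_norml.
apply/andP; split.
  suff : 0 <= M + poisson_mean s g - (M * (\sum_(0 <= n < N) poisson_weight s n)
      + \sum_(0 <= n < N) poisson_weight s n * g n) by lra.
  by rewrite subr_ge0; apply: H1 => n; have /andP[] := H n; lra.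
suff : 0 <= M - poisson_mean s g - (M * (\sum_(0 <= n < N) poisson_weight s n)
      - \sum_(0 <= n < N) poisson_weight s n * g n) by lra.
by rewrite subr_ge0; apply: H2 => n; have /andP[] := H n; lra.
Qed.

Lemma cvg_poisson_tail {R : realType} (s : R) :
  (fun N => 1 - \sum_(0 <= n < N) poisson_weight s n) @ \oo --> 0.
Proof.
have c1 := @cvg_poisson_mean _ _ s (bounded_seq_cst 1).
rewrite -[X in _ --> X](subrr (1 : R)) -{3}(poisson_mean_cst s 1).
apply: (cvg_seq_ext _ (cvgB (cvg_cst (1 : R)) c1)) => N.
by rewrite [LHS]/+%R/=; congr (_ - _); apply: eq_bigr => n _; rewrite mulr1.
Qed.

Lemma cvg_poisson_weight {R : realType} (s : R) :
  (fun N => poisson_weight s N) @ \oo --> 0.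
Proof.
rewrite -[X in _ --> X](mul0r (expR (- s))).
exact: cvgMr_tmp (cvg_exp_coeff s).
Qed.

(** Convexity as used from here on: tangent lines below the graph. The identity and the square
    satisfy it directly, as does every smooth convex function on an interval. *)
Definition tangent_convex {R : realType} (I : set R) (Phi : R -> R) : Prop :=
  [/\ is_interval I, forall x, I x -> derivable Phi x 1 &
      forall x y, I x -> I y -> Phi x + derive1 Phi x * (y - x) <= Phi y].

Section tangent_above.
Context {R : realType} (I : set R) (Phi : R -> R).
Context (cPhi : tangent_convex I Phi).
Context (a b : R) (Ia : I a) (Ib : I b).

Let I_itv : is_interval I. Proof. by case: cPhi. Qed.

Let dPhi x : I x -> derivable Phi x 1. Proof. by case: cPhi => _ + _; exact. Qed.

Let tanPhi x y : I x -> I y -> Phi x + derive1 Phi x * (y - x) <= Phi y.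
Proof. by case: cPhi => _ _; exact. Qed.

(** Since [derive1 Phi] is monotone on [I], its values at the two ends control it on [[a, b]]. *)
Let lip : R := `|derive1 Phi a| + `|derive1 Phi b|.
Let Phi_bound : R := `|Phi a| + lip * (b - a).

Let itv_sub x : a <= x <= b -> I x.
Proof. exact: I_itv. Qed.

(** Add the tangent inequalities at [x] and at [y]. *)
Lemma derive1_le x y : I x -> I y -> x <= y -> derive1 Phi x <= derive1 Phi y.
Proof.
move=> Ix Iy; rewrite le_eqVlt => /predU1P[->//|xy].
have := tanPhi Ix Iy; have := tanPhi Iy Ix.
have : 0 < y - x by lra.
move=> yx H1 H2; rewrite -(ler_pM2r yx); lra.
Qed.

Lemma B_transform_ge0 u v : I u -> I (u + v) -> 0 <= B_transform Phi u v.
Proof.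
move=> Iu Iuv; rewrite /B_transform.
by have := tanPhi Iu Iuv; have := tanPhi Iuv Iu; lra.
Qed.

Lemma A_transform_ge0 u v : I u -> I (u + v) -> 0 <= A_transform Phi u v.
Proof.
by move=> Iu Iuv; rewrite /A_transform; have := tanPhi Iu Iuv; lra.
Qed.

(** The difference [B(u, v) - A(u, v)] equals [A(u + v, - v)], the gap above the tangent at
    [u + v]. *)
Lemma A_transform_le_B u v : I u -> I (u + v) ->
  A_transform Phi u v <= B_transform Phi u v.
Proof.
move=> Iu Iuv; rewrite /A_transform /B_transform.
by have := tanPhi Iuv Iu; lra.
Qed.

Let derive1_bounded x : a <= x <= b -> `|derive1 Phi x| <= lip.
Proof.
move=> axb; have Ix := itv_sub axb; case/andP: axb => ax xb.
have := derive1_le Ia Ix ax; have := derive1_le Ix Ib xb.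
rewrite ler_norml /lip => H1 H2.
have := ler_norm (derive1 Phi b); have := ler_norm (- derive1 Phi a).
have := normr_ge0 (derive1 Phi b); have := normr_ge0 (derive1 Phi a).
by rewrite normrN => *; apply/andP; split; lra.
Qed.

Let Phi_bounded x : a <= x <= b -> `|Phi x| <= Phi_bound.
Proof.
move=> axb; have Ix := itv_sub axb; have dx := derive1_bounded axb.
have da : `|derive1 Phi a| <= lip by rewrite /lip lerDl.
case/andP: axb => ax xb.
have lip0 : 0 <= lip by exact: le_trans dx.
have H : `|Phi x - Phi a| <= lip * (b - a).
  apply: (@le_trans _ _ (lip * (x - a))); last by rewrite ler_wpM2l//; lra.
  have xa : 0 <= x - a by lra.
  rewrite ler_norml; apply/andP; split.
    have := tanPhi Ia Ix.
    have : - lip * (x - a) <= derive1 Phi a * (x - a).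
      by rewrite ler_wpM2r//; move: da; rewrite ler_norml => /andP[].
    lra.
  have := tanPhi Ix Ia.
  have : derive1 Phi x * (x - a) <= lip * (x - a).
    by rewrite ler_wpM2r//; move: dx; rewrite ler_norml => /andP[].
  lra.
rewrite /Phi_bound -(subrK (Phi a) (Phi x)) addrC.
by rewrite (le_trans (ler_normD _ _))// lerD.
Qed.

(** One constant for the three quantities met in boundary terms and tails; [x] and [y] stand for
    consecutive values of a sequence in [[a, b]]. *)
Lemma tangent_convex_bounded : exists M, forall x y,
  a <= x <= b -> a <= y <= b ->
  [/\ `|Phi x| <= M, `|derive1 Phi x * (y - x)| <= M &
      `|B_transform Phi x (y - x)| <= M].
Proof.
exists (Phi_bound + 2 * lip * (b - a)) => x y ax ay.
have bound0 : 0 <= Phi_bound by apply: le_trans (Phi_bounded ax).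
have lip0 : 0 <= lip by apply: le_trans (derive1_bounded ax).
have yx : `|y - x| <= b - a.
  rewrite ler_norml; case/andP: ax => ? ?; case/andP: ay => ? ?.
  by apply/andP; split; lra.
have lipba : 0 <= lip * (b - a) by rewrite mulr_ge0// (le_trans _ yx).
split.
- by apply: le_trans (Phi_bounded ax) _; lra.
- rewrite normrM; apply: (@le_trans _ _ (lip * (b - a))); last lra.
  by apply: ler_pM => //; exact: derive1_bounded.
- apply: (@le_trans _ _ (2 * lip * (b - a))); last lra.
  rewrite /B_transform normrM subrKC; apply: ler_pM => //.
  apply: le_trans (ler_normB _ _) _.
  by have := derive1_bounded ax; have := derive1_bounded ay; lra.
Qed.

Context (g : nat -> R) (gab : forall n, a <= g n <= b).

Lemma bounded_Phi_seq : bounded_seq (fun n => Phi (g n)).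
Proof. by exists Phi_bound => n; exact: Phi_bounded. Qed.

Lemma bounded_B_seq :
  bounded_seq (fun n => B_transform Phi (g n) (discrete_gradient g n)).
Proof.
have [M HM] := tangent_convex_bounded.
by exists M => n; have [] := HM _ _ (gab n) (gab n.+1).
Qed.

Lemma bounded_A_seq :
  bounded_seq (fun n => A_transform Phi (g n) (discrete_gradient g n)).
Proof.
have [M BM] := bounded_B_seq; exists M => n.
have Ign := itv_sub (gab n).
have Ign1 : I (g n + discrete_gradient g n) by rewrite subrKC; exact: itv_sub.
rewrite ger0_norm ?A_transform_ge0//.
by apply: le_trans (A_transform_le_B _ _) (le_trans (ler_norm _) (BM n)).
Qed.

End tangent_above.

(** * Interpolation along Poisson laws *)

(** The semigroup of the Poisson process: arrivals only, at unit rate during a time [s]. *)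
Definition poisson_shift {R : realType} (s : R) (g : nat -> R) (n : nat) : R :=
  poisson_mean s (fun k => g (n + k)%N).

Section poisson_shift.
Context {R : realType}.
Implicit Types (g : nat -> R) (s r : R).

Lemma bounded_shift g n : bounded_seq g -> bounded_seq (fun k => g (n + k)%N).
Proof. exact: (bounded_seq_comp (fun k => n + k)%N). Qed.

Lemma poisson_shift_itv s g a b : 0 <= s -> (forall n, a <= g n <= b) ->
  forall n, a <= poisson_shift s g n <= b.
Proof. by move=> s0 gab n; exact: poisson_mean_itv. Qed.

Lemma bounded_poisson_shift s g : 0 <= s -> bounded_seq g ->
  bounded_seq (poisson_shift s g).
Proof.
move=> s0 [M gM]; apply: (@bounded_seq_itv _ _ (- M) M).
by apply: poisson_shift_itv => // n; rewrite -ler_norml.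
Qed.

Lemma is_derive_poisson_shift r g n s : bounded_seq g ->
  is_derive s 1 (fun x => poisson_shift (r - x) g n)
    (- discrete_gradient (poisson_shift (r - s) g) n).
Proof.
move=> bg.
have D := is_derive_poisson_mean (r - s) (bounded_shift n bg).
have L : is_derive s 1 (fun x => r - x) (-1).
  apply: (is_derive_eq (is_deriveB (is_derive_cst r s 1) (is_derive_id s 1))).
  by rewrite add0r.
apply: (is_derive_eq (@is_derive1_comp _ _ (fun x => r - x) _ _ _ D L)).
rewrite mulrN1; congr (- _).
have bgS : bounded_seq (fun k => g (n + k.+1)%N).
  exact: (bounded_seq_comp (fun k => n + k.+1)%N).
rewrite /discrete_gradient poisson_meanB//; last exact: bounded_shift.
congr (_ - _); rewrite /poisson_shift; congr poisson_mean.
by apply/funext => k; rewrite addnS addSn.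
Qed.

End poisson_shift.

(* Duhamel interpolation [s |-> E_s Phi(E_(r - s) g)] along Poisson laws: the
   derivative of the partial sums of the outer mean telescopes, up to a
   boundary term, to the mean of [A_transform Phi]. *)
Section interpolation.
Context {R : realType} (I : set R) (Phi : R -> R).
Context (cPhi : tangent_convex I Phi).
Context (a b : R) (Ia : I a) (Ib : I b).
Context (g : nat -> R) (gab : forall n, a <= g n <= b).

Let bg : bounded_seq g. Proof. exact: bounded_seq_itv gab. Qed.

Lemma is_derive_interpolation (r s : R) (N : nat) : 0 <= s <= r ->
  let h x := poisson_shift (r - x) g in
  is_derive s 1
    (fun x => \sum_(0 <= n < N.+1) poisson_weight x n * Phi (h x n))
    (\sum_(0 <= n < N.+1) poisson_weight s n *
       A_transform Phi (h s n) (discrete_gradient (h s) n)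
     - poisson_weight s N * Phi (h s N.+1)).
Proof.
move=> /andP[s0 sr] h.
have [I_itv dPhi _] := cPhi.
have hab n : a <= h s n <= b by apply: poisson_shift_itv; rewrite ?subr_ge0.
pose dw n := (if n is k.+1 then poisson_weight s k else 0) - poisson_weight s n.
pose dh n := derive1 Phi (h s n) * (- discrete_gradient (h s) n).
have D n : is_derive s 1 (fun x => poisson_weight x n * Phi (h x n))
    (dw n * Phi (h s n) + poisson_weight s n * dh n).
  apply: is_deriveMr_fun; first exact: is_derive_poisson_weight.
  apply: (@is_derive1_comp _ Phi (h^~ n)); last exact: is_derive_poisson_shift.
  by constructor; [exact/dPhi/(I_itv a b)|rewrite derive1E].
apply: (is_derive_eq (is_derive_sum_nat (fun n _ => D n))).
(* The n-th term is [w_n A_n - w_n Phi(h(n+1)) + w_(n-1) Phi(h(n))], where [w] are the weights at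
   [s]; the last two parts telescope. *)
elim: N => [|N IH]; last rewrite big_nat_recr//= IH [in RHS]big_nat_recr//=;
  rewrite ?big_nat1 /dw /dh /A_transform subrKC /=; lra.
Qed.

(** The end time [s] is kept apart from [r]: [s = r] yields the entropic inequality, while arbitrary
    [s] with [Phi = id] yields the semigroup property. *)
Lemma interpolation_le (r s C : R) : 0 <= s <= r ->
  (forall x N, 0 <= x <= s ->
     \sum_(0 <= n < N.+1) poisson_weight x n *
       A_transform Phi (poisson_shift (r - x) g n)
         (discrete_gradient (poisson_shift (r - x) g) n) <= C) ->
  poisson_mean s (fun n => Phi (poisson_shift (r - s) g n)) -
  Phi (poisson_mean r g) <= C * s.
Proof.
move=> /andP[s0 sr] AC.
have [M HM] := tangent_convex_bounded cPhi Ia Ib.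
have hab x n : 0 <= x <= s -> a <= poisson_shift (r - x) g n <= b.
  move=> /andP[_ xs]; apply: poisson_shift_itv => //.
  by rewrite subr_ge0 (le_trans xs).
have M0 : 0 <= M.
  by have [H _ _] := HM _ _ (gab 0%N) (gab 0%N); exact: le_trans H.
(* The boundary term is bounded uniformly in [x <= s], using [e^(-x) <= 1] and [x^N <= s^N], by a
   quantity that vanishes as [N] grows. *)
have bnd x N : 0 <= x <= s ->
    - (poisson_weight x N * Phi (poisson_shift (r - x) g N.+1)) <=
    exp_coeff s N * M.
  move=> xs; have /andP[x0 xles] := xs.
  apply: le_trans (ler_norm _) _; rewrite normrN normrM.
  apply: ler_pM => //; last by have [] := HM _ _ (hab x N.+1 xs) (gab 0%N).
  rewrite ger0_norm ?poisson_weight_ge0// /poisson_weight /exp_coeff/=.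
  rewrite -[leRHS]mulr1 ler_pM ?expR_ge0 ?divr_ge0 ?exprn_ge0//.
    by rewrite ler_wpM2r ?invr_ge0// lerXn2r ?nnegrE// (le_trans x0).
  by rewrite -expR0 ler_expR oppr_le0.
pose F N x := \sum_(0 <= n < N.+1) poisson_weight x n *
  Phi (poisson_shift (r - x) g n).
have F0 N : F N 0 = Phi (poisson_mean r g).
  rewrite /F big_nat_recl//= big1 ?addr0 => [|n _].
    rewrite poisson_weight0 mul1r subr0 /poisson_shift.
    by congr (Phi (poisson_mean _ _)); apply/funext => k.
  by rewrite poisson_weight0 mul0r.
have FN N : F N s - Phi (poisson_mean r g) <= (C + exp_coeff s N * M) * s.
  rewrite -(F0 N) -[X in _ * X]subr0; apply: (derive_le_increment s0) => x xs.
    by apply: is_derive_interpolation; case/andP: xs => -> /le_trans->.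
  exact: (lerD (AC _ _ xs) (bnd _ _ xs)).
have cF : F N s - Phi (poisson_mean r g) @[N --> \oo] -->
    poisson_mean s (fun n => Phi (poisson_shift (r - s) g n)) -
    Phi (poisson_mean r g).
  apply: cvgB; last exact: cvg_cst.
  have hs n : a <= poisson_shift (r - s) g n <= b by apply: hab; rewrite s0 /=.
  have := @cvg_poisson_mean _ _ s (bounded_Phi_seq cPhi Ia Ib hs).
  by rewrite -(@cvg_shiftS _ (series _)).
have cC : (C + exp_coeff s N * M) * s @[N --> \oo] --> C * s.
  rewrite -[X in _ --> X * s]addr0 -[X in _ --> (_ + X) * s](mul0r M).
  apply: cvgMr_tmp; apply: cvgD; first exact: cvg_cst.
  by apply: cvgMr_tmp; exact: cvg_exp_coeff.
by apply: (ler_cvg_to cF cC); near=> N; exact: FN.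
Unshelve. all: by end_near. Qed.

End interpolation.

Lemma tangent_convex_id {R : realType} : tangent_convex setT (@id R).
Proof.
split => // x y _ _; rewrite derive1_id; lra.
Qed.

(** For [Phi = id] the transform [A] vanishes, so interpolation gives one inequality; applied to
    [- g] it gives the other. *)
Lemma poisson_mean_semigroup {R : realType} (r s : R) (g : nat -> R) :
  0 <= s <= r -> bounded_seq g ->
  poisson_mean s (poisson_shift (r - s) g) = poisson_mean r g.
Proof.
move=> /andP[s0 sr] bg.
have le_mean u : bounded_seq u ->
    poisson_mean s (poisson_shift (r - s) u) <= poisson_mean r u.
  move=> [M uM].
  have uMM n : - M <= u n <= M by rewrite -ler_norml.
  rewrite -subr_le0 -[leRHS](mul0r s).
  apply: (interpolation_le tangent_convex_id (a := - M) (b := M)) => //.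
    by rewrite s0.
  move=> x N _; rewrite big1// => n _; rewrite /A_transform derive1_id; lra.
apply/eqP; rewrite eq_le le_mean//= -lerN2.
have rs0 : 0 <= r - s by rewrite subr_ge0.
rewrite -!poisson_meanN//; last exact: bounded_poisson_shift.
apply: le_trans (le_mean _ (bounded_seqN bg)).
rewrite le_eqVlt; apply/orP; left; apply/eqP; congr poisson_mean.
by apply/funext => n; rewrite /poisson_shift poisson_meanN//;
  exact: bounded_shift.
Qed.

(** * The entropic inequality with [A_transform], for bounded functions *)

Section poisson_entropy.
Context {R : realType} (I : set R) (Phi : R -> R).
Context (cPhi : tangent_convex I Phi).
Context (tanA : forall u v, I u -> I (u + v) ->
  exists a b, forall u' v', I u' -> I (u' + v') ->
    A_transform Phi u v + a * (u' - u) + b * (v' - v) <= A_transform Phi u' v').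
Context (a b : R) (Ia : I a) (Ib : I b).
Context (g : nat -> R) (gab : forall n, a <= g n <= b).

Let bg : bounded_seq g. Proof. exact: bounded_seq_itv gab. Qed.

Let I_itv : is_interval I. Proof. by case: cPhi. Qed.

Let Ag n := A_transform Phi (g n) (discrete_gradient g n).

Let bAg : bounded_seq Ag. Proof. exact: (bounded_A_seq cPhi Ia Ib gab). Qed.

Let discrete_gradient_shift s n :
  discrete_gradient (poisson_shift s g) n =
  poisson_shift s (discrete_gradient g) n.
Proof.
rewrite /discrete_gradient /poisson_shift.
have bS : bounded_seq (fun k => g (n + k).+1).
  exact: (bounded_seq_comp (fun k => (n + k).+1)).
by rewrite poisson_meanB//; exact: bounded_shift.
Qed.

(** Jensen's inequality: average the supporting plane of [A_transform] at the mean point [(u, v)].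
    The mean of the gradient is [v] because the gradient commutes with [poisson_shift]. *)
Lemma A_transform_jensen s n : 0 <= s ->
  A_transform Phi (poisson_shift s g n)
    (discrete_gradient (poisson_shift s g) n) <= poisson_shift s Ag n.
Proof.
move=> s0.
have hab m : a <= poisson_shift s g m <= b by exact: poisson_shift_itv.
set u := poisson_shift s g n; set v := discrete_gradient _ n.
have Iu : I u by apply: (I_itv Ia Ib); exact: hab.
have Iuv : I (u + v) by rewrite subrKC; apply: (I_itv Ia Ib); exact: hab.
have [c [d tan]] := tanA Iu Iuv.
have bgn := bounded_shift n bg.
have bdn := bounded_shift n (bounded_discrete_gradient bg).
have bc (x : R) : bounded_seq (fun=> x) by exact: bounded_seq_cst.
have bc1 : bounded_seq (fun k => c * (g (n + k)%N - u)).
  exact/bounded_seqM/bounded_seqB.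
have bd1 : bounded_seq (fun k => d * (discrete_gradient g (n + k)%N - v)).
  exact/bounded_seqM/bounded_seqB.
have bcd := bounded_seqD (bounded_seqD (bc (A_transform Phi u v)) bc1) bd1.
(* The affine parts are centred, so they average to 0. *)
have -> : A_transform Phi u v = poisson_mean s (fun k =>
    A_transform Phi u v + c * (g (n + k)%N - u) +
    d * (discrete_gradient g (n + k)%N - v)).
  rewrite (poisson_meanD _ (bounded_seqD (bc _) bc1) bd1).
  rewrite (poisson_meanD _ (bc _) bc1) !poisson_meanZ; try exact: bounded_seqB.
  rewrite (poisson_meanB _ bgn (bc u)) (poisson_meanB _ bdn (bc v)).
  rewrite !poisson_mean_cst.
  have -> : poisson_mean s (fun k => g (n + k)%N) = u by [].
  have -> : poisson_mean s (fun k => discrete_gradient g (n + k)%N) = v.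
    by rewrite /v discrete_gradient_shift.
  by rewrite !subrr !mulr0 !addr0.
apply: poisson_mean_le => //; first exact: bounded_shift.
move=> k; apply: tan; first exact: (I_itv Ia Ib).
by rewrite subrKC; apply: (I_itv Ia Ib).
Qed.

Lemma poisson_A_entropic_inequality rho : 0 <= rho ->
  poisson_mean rho (fun n => Phi (g n)) - Phi (poisson_mean rho g) <=
  poisson_mean rho Ag * rho.
Proof.
move=> rho0.
have Ag0 n : 0 <= Ag n.
  apply: (A_transform_ge0 cPhi); first exact: (I_itv Ia Ib).
  by rewrite subrKC; apply: (I_itv Ia Ib).
have [M AM] := bAg.
have rr : 0 <= rho <= rho by rewrite rho0 /=.
have := @interpolation_le _ _ _ cPhi a b Ia Ib g gab rho rho
  (poisson_mean rho Ag) rr.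
have -> : poisson_shift (rho - rho) g = g.
  apply/funext => n; rewrite /poisson_shift subrr poisson_mean0 ?addn0//.
  exact: bounded_shift.
apply=> x N /andP[x0 xrho].
have rx0 : 0 <= rho - x by rewrite subr_ge0.
(* Splitting the mean at [rho] into [x] and [rho - x] gives both sides the same outer weights; they
   are then compared term by term, and the partial sum with the full mean. *)
rewrite -(@poisson_mean_semigroup _ rho x Ag) ?x0//.
apply: (@le_trans _ _ (\sum_(0 <= n < N.+1)
    poisson_weight x n * poisson_shift (rho - x) Ag n)).
  apply: ler_sum => n _; rewrite ler_wpM2l ?poisson_weight_ge0//.
  exact: A_transform_jensen.
apply: le_poisson_mean => //; first exact: bounded_poisson_shift.
have Ag0M n : 0 <= Ag n <= M by rewrite Ag0 (le_trans (ler_norm _) (AM n)).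
by move=> n; have /andP[] := poisson_shift_itv rx0 Ag0M n.
Qed.

End poisson_entropy.

(** * The M/M/oo semigroup *)

Section mminfty_mean_theory.
Context {R : realType}.
Implicit Types (f g : nat -> R) (rho p : R).

Lemma mminfty_meanB rho p f g n : bounded_seq f -> bounded_seq g ->
  mminfty_mean rho p (fun k => f k - g k) n =
  mminfty_mean rho p f n - mminfty_mean rho p g n.
Proof.
elim: n f g => [|n IH] f g bf bg /=; first by rewrite poisson_meanB.
rewrite IH// (IH (fun k => f k.+1) (fun k => g k.+1)); first by lra.
  exact: bounded_seq_comp.
exact: bounded_seq_comp.
Qed.

Lemma mminfty_meanN rho p f n : bounded_seq f ->
  mminfty_mean rho p (fun k => - f k) n = - mminfty_mean rho p f n.
Proof.
elim: n f => [|n IH] f bf /=; first by rewrite poisson_meanN.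
rewrite IH// (IH (fun k => f k.+1)); first by lra.
exact: bounded_seq_comp.
Qed.

Lemma mminfty_mean_itv rho p f a b : 0 <= rho -> 0 <= p <= 1 ->
  (forall n, a <= f n <= b) -> forall n, a <= mminfty_mean rho p f n <= b.
Proof.
move=> rho0 /andP[p0 p1] fab n; elim: n f fab => [|n IH] f fab /=.
  by apply: poisson_mean_itv => //; rewrite mulr_ge0// subr_ge0.
have /andP[h1 h2] := IH f fab.
have /andP[h3 h4] := IH (fun k => f k.+1) (fun k => fab k.+1).
have q0 : 0 <= 1 - p by rewrite subr_ge0.
have := ler_wpM2l q0 h1; have := ler_wpM2l q0 h2.
have := ler_wpM2l p0 h3; have := ler_wpM2l p0 h4.
by move=> *; apply/andP; split; lra.
Qed.

Lemma mminfty_mean1 rho f n : bounded_seq f -> mminfty_mean rho 1 f n = f n.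
Proof.
elim: n f => [|n IH] f bf /=; first by rewrite subrr mulr0 poisson_mean0.
by rewrite IH ?(IH (fun k => f k.+1)) ?subrr ?mul0r ?add0r ?mul1r//;
  exact: bounded_seq_comp.
Qed.

(* The commutation [D P_t = e^(- mu t) P_t D]. *)
Lemma discrete_gradient_mminfty_mean rho p f n : bounded_seq f ->
  discrete_gradient (mminfty_mean rho p f) n =
  p * mminfty_mean rho p (discrete_gradient f) n.
Proof.
move=> bf; rewrite /discrete_gradient mminfty_meanB//=; first by lra.
exact: bounded_seq_comp.
Qed.

(** The backward equation in the variable [p], before the chain rule for [p = e^(- mu t)]. At
    [n = 0] the index [n.-1] is 0, harmless under the factor [n%:R]. *)
Lemma is_derive_mminfty_mean rho p f n : bounded_seq f ->
  let X := mminfty_mean rho p (discrete_gradient f) in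
  is_derive p 1 (fun q => mminfty_mean rho q f n)
    (n%:R * X n.-1 - rho * X n).
Proof.
have L : is_derive p 1 (fun q : R => 1 - q) (- 1).
  apply: (is_derive_eq (is_deriveB (is_derive_cst (1 : R) p 1)
    (is_derive_id p 1))).
  by rewrite add0r.
elim: n f => [|n IH] f bf X.
  have M : is_derive p 1 (fun q => rho * (1 - q)) (- rho).
    apply: (is_derive_eq (is_deriveMr_fun (is_derive_cst rho p 1) L)).
    by rewrite mul0r add0r mulrN1.
  apply: (is_derive_eq (@is_derive1_comp _ (poisson_mean^~ f) _ _ _ _
    (is_derive_poisson_mean _ bf) M)).
  by rewrite /X /= mul0r sub0r mulrN mulrC.
have bfS : bounded_seq (fun k => f k.+1) by exact: bounded_seq_comp.
apply: (is_derive_eq (is_deriveD (is_deriveMr_fun L (IH f bf))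
  (is_deriveMr_fun (is_derive_id p 1) (IH _ bfS)))).
(* This difference comes from differentiating the coefficients [1 - q] and [q]; it raises the factor
   [n] to [n + 1]. *)
have XD : X n = mminfty_mean rho p (fun k => f k.+1) n - mminfty_mean rho p f n.
  exact: (mminfty_meanB _ _ _ bfS bf).
set Y := mminfty_mean rho p (discrete_gradient (fun k => f k.+1)).
have XS m : X m.+1 = (1 - p) * X m + p * Y m by [].
(* The recursion for [X] at [n] requires [n > 0]; the factor [n] covers [n = 0]. *)
have nX : n%:R * X n = n%:R * ((1 - p) * X n.-1 + p * Y n.-1).
  by case: (n) => [|m]; rewrite ?mul0r.
rewrite XS -natr1 succnK -/X; move: nX XD; clear.
move: (X n) (X n.-1) (Y n) (Y n.-1) (n%:R) => x x' y y' m.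
move: (mminfty_mean _ _ _ _) (mminfty_mean _ _ _ _) => c d nX XD.
lra.
Qed.

(** The backward equation [h' = L h], with [L] written through gradients. The factor [p] from the
    chain rule is absorbed by the commutation of gradient and semigroup. *)
Lemma is_derive_mminfty_semigroup (lambda mu t : R) f n : mu != 0 ->
  bounded_seq f ->
  let h s := mminfty_mean (lambda / mu) (expR (- (mu * s))) f in
  is_derive t 1 (fun s => h s n)
    (lambda * discrete_gradient (h t) n -
     mu * n%:R * discrete_gradient (h t) n.-1).
Proof.
move=> mu0 bf h.
have E : is_derive t 1 (fun s => expR (- (mu * s))) (- mu * expR (- (mu * t))).
  have L : is_derive t 1 (fun s => - (mu * s)) (- mu).
    have M := is_deriveMr_fun (is_derive_cst mu t 1) (is_derive_id t 1).
    by apply: (is_derive_eq (is_deriveN M)); rewrite mul0r add0r mulr1.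
  apply: (is_derive_eq
    (@is_derive1_comp R expR (fun s => - (mu * s)) _ _ _ _ L)).
  by rewrite mulrC.
apply: (is_derive_eq (@is_derive1_comp _
  (fun p => mminfty_mean (lambda / mu) p f n) _ _ _ _
  (is_derive_mminfty_mean (lambda / mu) _ n bf) E)).
rewrite !discrete_gradient_mminfty_mean//.
set X := mminfty_mean _ _ _; set p := expR _.
have rhoE : lambda = lambda / mu * mu by rewrite mulfVK.
by rewrite [in RHS]rhoE; lra.
Qed.

End mminfty_mean_theory.

(** * Dissipation of entropy along the semigroup *)

Section entropy_dissipation.
Context {R : realType} (I : set R) (Phi : R -> R).
Context (cPhi : tangent_convex I Phi).
Context (a b : R) (Ia : I a) (Ib : I b).
Context (f : nat -> R) (fab : forall n, a <= f n <= b).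
Context (lambda mu : R) (lambda_gt0 : 0 < lambda) (mu_gt0 : 0 < mu).

Let bf : bounded_seq f. Proof. exact: bounded_seq_itv fab. Qed.

Let rho := lambda / mu.

Let rho0 : 0 <= rho. Proof. by rewrite divr_ge0// ltW. Qed.

Let h t := mminfty_mean rho (expR (- (mu * t))) f.

Let hab t n : 0 <= t -> a <= h t n <= b.
Proof.
move=> t0; apply: mminfty_mean_itv => //.
by rewrite expR_ge0 -expR0 ler_expR oppr_le0 mulr_ge0// ltW.
Qed.

Let Bh t n := B_transform Phi (h t n) (discrete_gradient (h t) n).

(* Reversibility of the Poisson law turns the derivative of a partial sum into
   a partial sum of [B_transform], up to a boundary term. *)
Lemma is_derive_partial_entropy (t : R) (N : nat) : 0 <= t ->
  is_derive t 1
    (fun s => \sum_(0 <= n < N.+1) poisson_weight rho n * Phi (h s n))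
    (lambda * (poisson_weight rho N *
       (derive1 Phi (h t N) * discrete_gradient (h t) N)
     - \sum_(0 <= n < N) poisson_weight rho n * Bh t n)).
Proof.
move=> t0; have [I_itv dPhi _] := cPhi.
pose dh n := lambda * discrete_gradient (h t) n -
  mu * n%:R * discrete_gradient (h t) n.-1.
have D n : is_derive t 1 (fun s => poisson_weight rho n * Phi (h s n))
    (poisson_weight rho n * (derive1 Phi (h t n) * dh n)).
  have C : is_derive t 1 (fun s => Phi (h s n)) (derive1 Phi (h t n) * dh n).
    apply: (@is_derive1_comp _ Phi (h^~ n)).
      by constructor; [exact/dPhi/(I_itv a b)/hab|rewrite derive1E].
    by apply: is_derive_mminfty_semigroup; rewrite ?gt_eqF.
  apply: (is_derive_eq (is_deriveMr_fun (is_derive_cst _ t 1) C)).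
  by rewrite mul0r add0r.
apply: (is_derive_eq (is_derive_sum_nat (fun n _ => D n))).
elim: N => [|N IH].
  by rewrite big_nat1 big_nil /dh mulr0 mul0r !subr0; lra.
rewrite big_nat_recr//= IH [in RHS]big_nat_recr//= /dh /Bh /B_transform subrKC.
(* This turns the departure term at [N + 1] into an arrival term at [N], which combines with the old
   boundary term into [- lambda] times the weighted [B_transform] at [N]. *)
have detailed_balance : mu * N.+1%:R * poisson_weight rho N.+1 =
    lambda * poisson_weight rho N.
  rewrite -mulrA poisson_weightS mulrA; congr (_ * _).
  by rewrite /rho mulrCA divff ?mulr1// gt_eqF.
set S := \sum_(0 <= i < N) _.
move: detailed_balance; rewrite succnK; set m := mu * _.
move: (discrete_gradient _ N) (discrete_gradient _ N.+1) => d d' E.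
set p := derive1 Phi _; set p' := derive1 Phi (h t N.+1).
set w := poisson_weight _ N in E *; set w' := poisson_weight _ _ in E *.
have -> : w' * (p' * (lambda * d' - m * d)) =
  lambda * w' * p' * d' - m * w' * (p' * d) by lra.
by rewrite E; lra.
Qed.

(** A Gronwall argument on partial sums. The constant [C] stands for [Phi] of the mean; it is a
    parameter because invariance of that mean is itself deduced from this lemma, with [Phi = id] and
    [k = C = 0]. *)
Lemma entropy_decay (k C s t : R) : 0 <= s -> s <= t ->
  (forall x, 0 <= x ->
     k * (poisson_mean rho (fun n => Phi (h x n)) - C) <=
     lambda * poisson_mean rho (Bh x)) ->
  expR (k * t) * (poisson_mean rho (fun n => Phi (h t n)) - C) <=
  expR (k * s) * (poisson_mean rho (fun n => Phi (h s n)) - C).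
Proof.
move=> s0 st kB.
have [M HM] := tangent_convex_bounded cPhi Ia Ib.
have bound x n : 0 <= x -> [/\ `|Phi (h x n)| <= M,
    `|derive1 Phi (h x n) * discrete_gradient (h x) n| <= M & `|Bh x n| <= M].
  by move=> x0; exact: HM (hab n x0) (hab n.+1 x0).
have M0 : 0 <= M.
  by have [H _ _] := bound 0 0%N (lexx 0); exact: le_trans H.
pose F N x := \sum_(0 <= n < N.+1) poisson_weight rho n * Phi (h x n).
pose tail N := 1 - \sum_(0 <= n < N) poisson_weight rho n.
(* Bounds the derivative on [[s, t]]: the tail of the mean of [Phi], the boundary term and the tail
   of the mean of [B_transform]. The absolute value covers either sign of [k]. *)
pose err N : R := expR (`|k| * t) *
  (`|k| * (M * tail N.+1) + lambda * (poisson_weight rho N * M + M * tail N)).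
have FN N : expR (k * t) * (F N t - C) - expR (k * s) * (F N s - C) <=
    err N * (t - s).
  pose dF N x := lambda * (poisson_weight rho N *
       (derive1 Phi (h x N) * discrete_gradient (h x) N)
     - \sum_(0 <= n < N) poisson_weight rho n * Bh x n).
  apply: (@derive_le_increment _ (fun x => expR (k * x) * (F N x - C))
    (fun x => k * expR (k * x) * (F N x - C) + expR (k * x) * dF N x)) => //.
    move=> x /andP[sx xt]; apply: is_deriveMr_fun.
      have L := is_deriveMr_fun (is_derive_cst k x 1) (is_derive_id x 1).
      apply: (is_derive_eq (@is_derive1_comp R expR (fun x => k * x) _ _ _ _ L)).
      by rewrite mul0r add0r mulr1 mulrC.
    have D := is_derive_partial_entropy N (le_trans s0 sx).
    by apply: (is_derive_eq (is_deriveB D (is_derive_cst C x 1))); rewrite subr0.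
  move=> x /andP[sx xt]; have x0 := le_trans s0 sx.
  rewrite [leLHS](_ : _ = expR (k * x) * (k * (F N x - C) + dF N x)); last by lra.
  have tail0 n : 0 <= tail n.
    have := @le_poisson_mean _ rho (fun=> 1) n rho0 (bounded_seq_cst _).
    rewrite poisson_mean_cst subr_ge0; under eq_bigr do rewrite mulr1.
    exact.
  have w0 := poisson_weight_ge0 N rho0.
  have K0 : 0 <= `|k| * (M * tail N.+1) by rewrite !mulr_ge0.
  have L0 : 0 <= lambda * (poisson_weight rho N * M + M * tail N).
    by apply: mulr_ge0; [exact: ltW|rewrite addr_ge0// mulr_ge0].
  apply: (@le_trans _ _ (expR (k * x) * (`|k| * (M * tail N.+1) +
      lambda * (poisson_weight rho N * M + M * tail N)))); last first.
    rewrite ler_wpM2r ?addr_ge0// ler_expR.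
    apply: le_trans (ler_norm _) _; rewrite normrM ler_wpM2l//.
    by rewrite ger0_norm.
  rewrite ler_wpM2l ?expR_ge0//.
  have tF : `|poisson_mean rho (fun n => Phi (h x n)) - F N x| <= M * tail N.+1.
    by apply: poisson_mean_tail => // n; have [] := bound x n x0.
  have tB : `|poisson_mean rho (Bh x) -
      \sum_(0 <= n < N) poisson_weight rho n * Bh x n| <= M * tail N.
    by apply: poisson_mean_tail => // n; have [] := bound x n x0.
  have kF : k * (F N x - poisson_mean rho (fun n => Phi (h x n))) <=
      `|k| * (M * tail N.+1).
    apply: le_trans (ler_norm _) _; rewrite normrM ler_wpM2l//.
    by rewrite distrC.
  have wD : poisson_weight rho N *
      (derive1 Phi (h x N) * discrete_gradient (h x) N) <=
      poisson_weight rho N * M.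
    rewrite ler_wpM2l//; apply: le_trans (ler_norm _) _.
    by have [] := bound x N x0.
  have lB : lambda * (poisson_mean rho (Bh x) -
      \sum_(0 <= n < N) poisson_weight rho n * Bh x n) <= lambda * (M * tail N).
    by rewrite ler_pM2l//; exact: le_trans (ler_norm _) tB.
  have lD : lambda * (poisson_weight rho N *
      (derive1 Phi (h x N) * discrete_gradient (h x) N)) <=
      lambda * (poisson_weight rho N * M) by rewrite ler_pM2l.
  by have := kB x x0; rewrite /dF; lra.
have cF x : 0 <= x -> expR (k * x) * (F N x - C) @[N --> \oo] -->
    expR (k * x) * (poisson_mean rho (fun n => Phi (h x n)) - C).
  move=> x0; apply: cvgMl_tmp; apply: cvgB; last exact: cvg_cst.
  have hx n : a <= h x n <= b by exact: hab.
  have := @cvg_poisson_mean _ _ rho (bounded_Phi_seq cPhi Ia Ib hx).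
  by rewrite -(@cvg_shiftS _ (series _)).
have cE : err N * (t - s) @[N --> \oo] --> 0.
  have ctail := @cvg_poisson_tail R rho.
  have ctailS : tail N.+1 @[N --> \oo] --> 0 by rewrite (@cvg_shiftS _ tail).
  have c1 : `|k| * (M * tail N.+1) @[N --> \oo] --> `|k| * (M * 0).
    by do 2 apply: cvgMl_tmp.
  have c2 : lambda * (poisson_weight rho N * M + M * tail N) @[N --> \oo] -->
      lambda * (0 * M + M * 0).
    apply: cvgMl_tmp; apply: cvgD; last exact: cvgMl_tmp.
    by apply: cvgMr_tmp; exact: cvg_poisson_weight.
  suff : err N * (t - s) @[N --> \oo] --> expR (`|k| * t) *
      (`|k| * (M * 0) + lambda * (0 * M + M * 0)) * (t - s).
    by rewrite !(mulr0, mul0r, addr0).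
  by apply: cvgMr_tmp; apply: cvgMl_tmp; exact: cvgD.
have t0 := le_trans s0 st.
rewrite -subr_le0; apply: (ler_cvg_to (cvgB (cF t t0) (cF s s0)) cE).
by near=> N; exact: FN.
Unshelve. all: by end_near. Qed.

End entropy_dissipation.

(** * Reduction to bounded functions *)

(** The identity attains its extrema on the compact set [closure (range f)] intersected with [I], so
    the two bounds belong to [I]. *)
Lemma Kfun_itv {R : realType} (I : set R) (f : nat -> R) : Kfun I f ->
  exists a b, [/\ I a, I b & forall n, a <= f n <= b].
Proof.
move=> [fI cK]; set K := closure _ `&` I in cK.
have Kf n : K (f n).
  by split; [apply: subset_closure; exists n|apply: fI; exists n].
have K0 : K !=set0 by exists (f 0%N).
have cid : {within K, continuous (@id R)}.
  by apply: continuous_subspaceT => x; exact: cvg_id.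
have [b /set_mem[_ Ib] Kb] := compact_EVT_max K0 cK cid.
have [a /set_mem[_ Ia] Ka] := compact_EVT_min K0 cK cid.
by exists a, b; split => // n; rewrite Ka ?Kb ?mem_set.
Qed.

Lemma prefix_itv {R : realType} (I : set R) (g : nat -> R) (k : nat) :
  (forall n, I (g n)) ->
  exists a b, [/\ I a, I b & forall n, (n <= k)%N -> a <= g n <= b].
Proof.
move=> gI; elim: k => [|k [a [b [Ia Ib gab]]]].
  by exists (g 0%N), (g 0%N); split => // n; rewrite leqn0 => /eqP->; rewrite lexx.
exists (Num.min a (g k.+1)), (Num.max b (g k.+1)); split.
- by rewrite minEle; case: ifP.
- by rewrite maxEle; case: ifP.
- move=> n; rewrite leq_eqVlt => /predU1P[->|].
    by rewrite ge_min le_max lexx !orbT.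
  by rewrite ltnS => /gab /andP[h1 h2]; rewrite ge_min le_max h1 h2.
Qed.

(** * Poisson tails and stopped functions *)

Section stopping.
Context {R : realType} (rho : R) (rho0 : 0 <= rho).
Implicit Types u g : nat -> R.

(** The binomial coefficient of [k + j] over [j] is at least 1, so [k! j! <= (k + j)!]. *)
Lemma poisson_weight_addn_le k j :
  poisson_weight rho (k + j) <= poisson_weight rho k * exp_coeff rho j.
Proof.
rewrite /poisson_weight /exp_coeff/= exprD [leRHS]mulrAC ler_wpM2r ?expR_ge0//.
rewrite mulrACA -invfM ler_wpM2l ?mulr_ge0 ?exprn_ge0//.
rewrite lef_pV2 ?posrE ?mulr_gt0 ?ltr0n ?fact_gt0// -natrM ler_nat.
rewrite -(bin_fact (leq_addr j k)) addKn leq_pmull// bin_gt0 leq_addr//.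
Qed.

(** Sum the previous bound over [j]: the tail from [k] on is comparable to its first mass. *)
Lemma poisson_tail_le k :
  0 <= 1 - \sum_(0 <= n < k) poisson_weight rho n <=
    poisson_weight rho k * expR rho.
Proof.
have b1 := bounded_seq_cst (1 : R).
have sum1 N : \sum_(0 <= n < N) poisson_weight rho n * 1 =
    \sum_(0 <= n < N) poisson_weight rho n.
  by apply: eq_bigr => n _; rewrite mulr1.
rewrite subr_ge0 -{1}(poisson_mean_cst rho 1) -sum1 le_poisson_mean//=.
rewrite lerBlDl.
have := @cvg_poisson_mean _ _ rho b1; rewrite poisson_mean_cst => c1.
apply: (cvgr_to_le c1); exists k => // N /= kN; rewrite /series/=.
rewrite (@big_cat_nat _ _ _ k)//= lerD2l.
rewrite -{1}[k]add0n big_addn.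
have w0 n : 0 <= poisson_weight rho n by exact: poisson_weight_ge0.
apply: (@le_trans _ _ (poisson_weight rho k * expR rho *
    \sum_(0 <= j < N - k) poisson_weight rho j * 1)).
  rewrite mulr_sumr; apply: ler_sum => j _; rewrite !mulr1 addnC.
  apply: le_trans (poisson_weight_addn_le k j) _.
  rewrite -mulrA ler_wpM2l// /poisson_weight mulrCA mulrC.
  by rewrite expRxMexpNx_1 mul1r.
have wk : 0 <= poisson_weight rho k * expR rho.
  by apply: mulr_ge0; rewrite ?expR_ge0.
rewrite -[leRHS]mulr1 ler_wpM2l//.
by rewrite -[leRHS](poisson_mean_cst rho 1) le_poisson_mean.
Qed.

Definition stopped u k n : R := u (minn n k).

(** After subtracting the constant [u k], the stopped sequence has finite support. *)
Lemma poisson_mean_stopped u k : poisson_mean rho (stopped u k) =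
  \sum_(0 <= n < k) poisson_weight rho n * u n +
  (1 - \sum_(0 <= n < k) poisson_weight rho n) * u k.
Proof.
have bs : bounded_seq (fun n => stopped u k n - u k).
  have [a [b [_ _ uab]]] := @prefix_itv R setT u k (fun=> I).
  apply: bounded_seqB (bounded_seq_cst _).
  by apply: (@bounded_seq_itv _ _ a b) => n; apply: uab; rewrite geq_minr.
have mean0 : poisson_mean rho (fun n => stopped u k n - u k) =
    \sum_(0 <= n < k) poisson_weight rho n * (u n - u k).
  apply: (cvg_seq_unique (@cvg_poisson_mean _ _ rho bs)).
  apply: cvg_near_cst; exists k => // N /= kN; rewrite /series/=.
  rewrite (@big_cat_nat _ _ _ k)//= [X in _ + X]big_nat [X in _ + X]big1.
    rewrite addr0; apply: eq_big_nat => n /andP[_ nk].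
    by rewrite /stopped (minn_idPl (ltnW nk)).
  by move=> n /andP[kn _]; rewrite /stopped (minn_idPr kn) subrr mulr0.
rewrite (_ : stopped u k = fun n => (stopped u k n - u k) + u k); last first.
  by apply/funext => n; rewrite subrK.
rewrite poisson_meanD//; last exact: bounded_seq_cst.
rewrite poisson_mean_cst mean0; under eq_bigr do rewrite mulrBr.
by rewrite sumrB -mulr_suml; lra.
Qed.

(* The mass beyond [k] is at most [e^rho] times the mass at [k], so the stopped
   value does not contribute in the limit as soon as [u] is integrable. *)
Lemma cvg_poisson_mean_stopped u :
  (poisson_law rho).-integrable setT (EFin \o u) ->
  poisson_mean rho (stopped u k) @[k --> \oo] --> \int[poisson_law rho]_n u n.
Proof.
move=> intu; have c := cvg_poisson_integral rho0 intu.
apply: (cvg_seq_ext (fun k => esym (poisson_mean_stopped u k))).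
rewrite -[X in _ --> X]addr0; apply: cvgD; first exact: c.
have c0 : `|poisson_weight rho k * u k| * expR rho @[k --> \oo] --> 0.
  rewrite -(mul0r (expR rho)) -{1}(@normr0 _ R); apply: cvgMr_tmp; apply: cvg_norm.
  by apply: cvg_series_cvg_0; apply/cvg_ex; eexists; exact: c.
apply/norm_cvg0P; apply: (squeeze_cvgr _ (cvg_cst 0) c0); near=> k.
rewrite normr_ge0 /= [leLHS]normrM (normrM (poisson_weight rho k)) mulrAC.
rewrite ler_wpM2r//.
have /andP[h1 h2] := poisson_tail_le k.
by rewrite (ger0_norm h1) (ger0_norm (poisson_weight_ge0 k rho0)).
Unshelve. all: by end_near. Qed.

Lemma poisson_integral_le0 u :
  (poisson_law rho).-integrable setT (EFin \o u) ->
  \int[poisson_law rho]_n u n = 0 -> exists n, u n <= 0.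
Proof.
move=> intu u0; apply: contrapT => /forallNP un.
have upos n : 0 < u n by rewrite ltNge; apply/negP.
have w0 : 0 < poisson_weight rho 0.
  by rewrite /poisson_weight expr0 fact0 divr1 mul1r expR_gt0.
suff : poisson_weight rho 0 * u 0%N <= 0.
  by rewrite leNgt mulr_gt0.
have c := cvg_poisson_integral rho0 intu; rewrite u0 in c.
apply: (cvgr_to_ge c); exists 1%N => // -[//|N] _.
rewrite /series/= big_nat_recl//= lerDl sumr_ge0// => n _.
by rewrite mulr_ge0 ?poisson_weight_ge0// ltW.
Qed.

(** A centred integrable function takes a value [<= 0]. Applied to [g - m] and [m - g], this gives
    values of [g] on both sides of [m], so [m] lies in [I] even when [I] excludes its end points. *)
Lemma poisson_integral_itv (I : set R) g : is_interval I ->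
  (poisson_law rho).-integrable setT (EFin \o g) -> (forall n, I (g n)) ->
  I (\int[poisson_law rho]_n g n).
Proof.
move=> I_itv intg gI; set m := \int[_]_n g n.
have intm : (poisson_law rho).-integrable setT (EFin \o cst m).
  exact: integrable_bounded_seq (bounded_seq_cst m).
have mm : \int[poisson_law rho]_n cst m n = m.
  by rewrite (Rintegral_poisson rho0 (bounded_seq_cst m)) poisson_mean_cst.
have [i gi] : exists n, g n - m <= 0.
  apply: poisson_integral_le0; first exact: (integrableB measurableT intg intm).
  by rewrite RintegralB// mm subrr.
have [j gj] : exists n, m - g n <= 0.
  apply: poisson_integral_le0; first exact: (integrableB measurableT intm intg).
  by rewrite RintegralB// mm subrr.
by apply: (I_itv (g i) (g j)) => //; rewrite -subr_le0 gi -subr_le0.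
Qed.

End stopping.

(** * Passage to general functions, and decay for the semigroup *)

Section mminfty_entropy.
Context {R : realType} (I : set R) (Phi : R -> R).
Context (cPhi : tangent_convex I Phi).
Context (lambda mu : R) (lambda_gt0 : 0 < lambda) (mu_gt0 : 0 < mu).

Let rho := lambda / mu.

Let rho0 : 0 <= rho. Proof. by rewrite divr_ge0// ltW. Qed.

Let I_itv : is_interval I. Proof. by case: cPhi. Qed.

Let B_ge0 (g : nat -> R) n : (forall n, I (g n)) ->
  0 <= B_transform Phi (g n) (discrete_gradient g n).
Proof. by move=> gI; apply: (B_transform_ge0 cPhi); rewrite ?subrKC. Qed.

(** For each [k] the right-hand side of the stopped inequality is at most that for [g], so only the
    left-hand side is passed to the limit. *)
Lemma B_entropic_inequality_bounded (c : R) :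
  (forall a b g, I a -> I b -> (forall n, a <= g n <= b) ->
     c * mu * (poisson_mean rho (fun n => Phi (g n)) -
               Phi (poisson_mean rho g)) <=
     lambda * poisson_mean rho
       (fun n => B_transform Phi (g n) (discrete_gradient g n))) ->
  B_entropic_inequality I Phi lambda mu c.
Proof.
move=> bounded_ineq Q g [intg gI intPhig].
pose Bg n := (B_transform Phi (g n) (discrete_gradient g n))%:E.
have stopI k n : I (stopped g k n) by exact: gI.
rewrite -/(Bg _); set X := (\int[Q]_n Bg n)%E.
have stop_le k : ((c * mu * (poisson_mean rho (stopped (Phi \o g) k) -
    Phi (poisson_mean rho (stopped g k))))%:E <= lambda%:E * X)%E.
  have [a [b [Ia Ib gab]]] := prefix_itv k gI.
  have sab n : a <= stopped g k n <= b by apply: gab; rewrite geq_minr.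
  have := bounded_ineq a b _ Ia Ib sab; rewrite -lee_fin => /le_trans; apply.
  rewrite EFinM lee_pmul2l ?lte_fin//.
  rewrite -integral_poisson//; last exact: (bounded_B_seq cPhi Ia Ib sab).
  apply: ge0_le_integral => //.
  - by move=> n _; rewrite lee_fin B_ge0.
  (* Before [k] the two integrands coincide; from [k] on the stopped gradient is 0. *)
  - move=> n _; rewrite lee_fin /discrete_gradient /stopped.
    case: (ltnP n k) => [nk|kn].
      by rewrite (minn_idPl nk).
    rewrite (minn_idPr (leqW kn)) subrr /B_transform mulr0.
    exact: B_ge0.
have cvgEnt : c * mu * (poisson_mean rho (stopped (Phi \o g) k) -
    Phi (poisson_mean rho (stopped g k))) @[k --> \oo] --> c * mu * Ent Phi Q g.
  apply: cvgMl_tmp; apply: cvgB; first exact: cvg_poisson_mean_stopped.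
  (* Continuity of [Phi] is used at the mean of [g], which belongs to [I]. *)
  apply: continuous_cvg; last exact: cvg_poisson_mean_stopped.
  apply: differentiable_continuous; apply/derivable1_diffP.
  by have [_ dPhi _] := cPhi; apply: dPhi; exact: poisson_integral_itv.
have X0 : (0 <= X)%E by apply: integral_ge0 => n _; rewrite lee_fin B_ge0.
case: X X0 stop_le => [x| |] //= _ stop_le; last first.
  by rewrite mulry gtr0_sg// mul1e leey.
rewrite -EFinM lee_fin; apply: (cvgr_to_le cvgEnt).
by near=> k; rewrite -lee_fin EFinM; exact: stop_le.
Unshelve. all: by end_near. Qed.

Lemma Ent_poisson (g : nat -> R) a b : I a -> I b ->
  (forall n, a <= g n <= b) -> Ent Phi (poisson_law rho) g =
  poisson_mean rho (fun n => Phi (g n)) - Phi (poisson_mean rho g).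
Proof.
move=> Ia Ib gab; rewrite /Ent !Rintegral_poisson//.
  exact: bounded_seq_itv gab.
exact: (bounded_Phi_seq cPhi Ia Ib gab).
Qed.

(** For [Phi = id] the transform [B] vanishes, so the mean cannot increase along the semigroup; the
    same for [- f] gives equality. *)
Lemma mminfty_invariant (f : nat -> R) (t : R) : 0 <= t -> bounded_seq f ->
  poisson_mean rho (mminfty_mean rho (expR (- (mu * t))) f) =
  poisson_mean rho f.
Proof.
move=> t0.
have le_mean g : bounded_seq g ->
    poisson_mean rho (mminfty_mean rho (expR (- (mu * t))) g) <=
    poisson_mean rho g.
  move=> [M gM]; have gMM n : - M <= g n <= M by rewrite -ler_norml.
  have bg : bounded_seq g by exists M.
  have := @entropy_decay _ setT _ (@tangent_convex_id R) (- M) M Logic.I Logic.I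
    g gMM lambda mu lambda_gt0 mu_gt0 0 0 0 t (lexx 0) t0.
  rewrite !mul0r !mulr0 !oppr0 expR0 !mul1r !addr0.
  have -> : mminfty_mean (lambda / mu) 1 g = g.
    by apply/funext => n; exact: mminfty_mean1.
  apply => x x0; rewrite mul0r (_ : (fun n => _) = (fun=> 0)).
    by rewrite poisson_mean_cst mulr0.
  by apply/funext => n; rewrite /B_transform !derive1_id subrr mul0r.
move=> bf; apply/eqP; rewrite eq_le le_mean//= -lerN2.
have hN : (fun n => - mminfty_mean rho (expR (- (mu * t))) f n) =
    mminfty_mean rho (expR (- (mu * t))) (fun n => - f n).
  by apply/funext => n; rewrite mminfty_meanN.
have bh : bounded_seq (mminfty_mean rho (expR (- (mu * t))) f).
  move: bf => [M fM]; apply: (@bounded_seq_itv _ _ (- M) M).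
  apply: mminfty_mean_itv => // [|n]; last by rewrite -ler_norml.
  by rewrite expR_ge0 -expR0 ler_expR oppr_le0 mulr_ge0// ltW.
by rewrite -!poisson_meanN// hN le_mean//; exact: bounded_seqN.
Qed.

(** Comparing two times [s <= t] serves both claims: [c = 0] gives monotonicity, [s = 0] the
    exponential bound. *)
Lemma Ent_mminfty_decay (f : nat -> R) (c s t : R) : Kfun I f ->
  B_entropic_inequality I Phi lambda mu c -> 0 <= s -> s <= t ->
  expR (c * mu * t) * Ent Phi (poisson_law rho) (mminfty_semigroup lambda mu t f)
  <= expR (c * mu * s) *
     Ent Phi (poisson_law rho) (mminfty_semigroup lambda mu s f).
Proof.
move=> Kf Bc s0 st; have [a [b [Ia Ib fab]]] := Kfun_itv Kf.
have bf := bounded_seq_itv fab.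
have t0 := le_trans s0 st.
pose h x := mminfty_mean rho (expR (- (mu * x))) f.
have hab x : 0 <= x -> forall n, a <= h x n <= b.
  move=> x0; apply: mminfty_mean_itv => //.
  by rewrite expR_ge0 -expR0 ler_expR oppr_le0 mulr_ge0// ltW.
have EntE x : 0 <= x -> Ent Phi (poisson_law rho) (h x) =
    poisson_mean rho (fun n => Phi (h x n)) - Phi (poisson_mean rho f).
  by move=> x0; rewrite (Ent_poisson Ia Ib (hab x x0)) mminfty_invariant.
rewrite !mminfty_semigroupE// !EntE//.
apply: (entropy_decay cPhi Ia Ib fab lambda_gt0 mu_gt0 s0 st) => x x0.
rewrite -EntE//.
have bPhih := bounded_Phi_seq cPhi Ia Ib (hab x x0).
have := Bc (h x); rewrite integral_poisson//; last first.
  exact: (bounded_B_seq cPhi Ia Ib (hab x x0)).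
rewrite -EFinM lee_fin; apply; split.
- exact/integrable_bounded_seq/(bounded_seq_itv (hab x x0)).
- by move=> n; apply: (I_itv Ia Ib); exact: hab.
- exact: integrable_bounded_seq.
Qed.

End mminfty_entropy.

(** * The square function, and assembly of the theorem *)

Lemma is_derive_sqr {R : realType} (x : R) :
  is_derive x 1 (fun u : R => u ^+ 2) (2 * x).
Proof.
apply: (is_derive_eq (is_deriveMr_fun (is_derive_id x 1) (is_derive_id x 1))).
by lra.
Qed.

Lemma derive1_sqr {R : realType} (x : R) :
  derive1 (fun u : R => u ^+ 2) x = 2 * x.
Proof.
by rewrite derive1E; exact: (@derive_val _ _ _ _ _ _ _ (is_derive_sqr x)).
Qed.

Lemma tangent_convex_sqr {R : realType} :
  tangent_convex setT (fun u : R => u ^+ 2).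
Proof.
split => // x y _ _.
by rewrite derive1_sqr; have := sqr_ge0 (y - x); lra.
Qed.

Lemma smooth_tangent_convex {R : realType} (I : set R) (Phi : R -> R) :
  is_interval I -> smooth_on I Phi ->
  convex_function (I : set (convex_lmodType R^o)) Phi -> tangent_convex I Phi.
Proof.
move=> I_itv sPhi cPhi; split => // [x Ix|x y Ix Iy]; first exact: (sPhi 0%N).
by apply: convex_tangent => //; exact: (sPhi 0%N).
Qed.

Theorem theorem3p1 (R : realType) (I : set R) (Phi : R -> R) (lambda mu : R)
    (I_open : open I) (I_itv : is_interval I)
    (Phi_smooth : smooth_on I Phi)
    (Phi_convex : convex_function (I : set (convex_lmodType R^o)) Phi)
    (lambda_gt0 : 0 < lambda) (mu_gt0 : 0 < mu) :
  let Q := poisson_law (lambda / mu) in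
  let Pt := mminfty_semigroup lambda mu in
  [/\ (forall f, Kfun I f -> forall s t : R, 0 <= s -> s <= t ->
         Ent Phi Q (Pt t f) <= Ent Phi Q (Pt s f)),
      (A_convex I Phi ->
         forall f, Kfun I f -> forall t : R, 0 <= t ->
         forall c : R, B_entropic_inequality I Phi lambda mu c ->
         Ent Phi Q (Pt t f) <= expR (- (c * mu * t)) * Ent Phi Q f),
      (A_convex I Phi ->
         B_entropic_inequality I Phi lambda mu 1) &
      B_entropic_inequality [set: R] (fun u : R => u ^+ 2) lambda mu 2].
Proof.
move=> Q Pt; have tPhi := smooth_tangent_convex I_itv Phi_smooth Phi_convex.
have rho0 : 0 <= lambda / mu by rewrite divr_ge0// ltW.
have lambdaE : mu * (lambda / mu) = lambda by rewrite mulrC divfK// gt_eqF.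
split.
- move=> f Kf s t s0 st.
  (* With [c = 0] the inequality is just the nonnegativity of [B_transform]. *)
  have B0 : B_entropic_inequality I Phi lambda mu 0.
    move=> g [_ gI _]; rewrite !mul0r; apply: mule_ge0.
      by rewrite lee_fin ltW.
    apply: integral_ge0 => n _; rewrite lee_fin.
    by apply: (B_transform_ge0 tPhi); rewrite ?subrKC.
  have e1 x : expR (0 * mu * x) = 1 by rewrite !mul0r expR0.
  have := Ent_mminfty_decay tPhi lambda_gt0 mu_gt0 Kf B0 s0 st.
  rewrite !e1 [X in X <= _ -> _]mul1r [X in _ <= X -> _]mul1r; exact.
- move=> _ f Kf t t0 c Bc.
  have := Ent_mminfty_decay tPhi lambda_gt0 mu_gt0 Kf Bc (lexx 0) t0.
  have -> : mminfty_semigroup lambda mu 0 f = f.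
    have [a [b [_ _ fab]]] := Kfun_itv Kf; have bf := bounded_seq_itv fab.
    rewrite mminfty_semigroupE// mulr0 oppr0 expR0.
    by apply/funext => n; exact: mminfty_mean1.
  by rewrite mulr0 expR0 mul1r expRN ler_pdivlMl ?expR_gt0.
- move=> cA; apply: (B_entropic_inequality_bounded tPhi) => //.
  move=> a b g Ia Ib gab; rewrite mul1r.
  have tanA u v : I u -> I (u + v) -> exists a b, forall u' v',
      I u' -> I (u' + v') -> A_transform Phi u v + a * (u' - u) + b * (v' - v) <=
      A_transform Phi u' v'.
    move=> Iu Iuv; apply: (A_convex_tangent cA _ _ _ Iu Iuv).
    + exact: (Phi_smooth 0%N u Iu).
    + exact: (Phi_smooth 0%N _ Iuv).
    + exact: (Phi_smooth 1%N u Iu).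
  have := poisson_A_entropic_inequality tPhi tanA Ia Ib gab rho0.
  (* Multiplying by [mu] turns the factor [rho] into [lambda]; then [A <= B] concludes. *)
  move/(ler_wpM2l (ltW mu_gt0)) => /le_trans; apply.
  rewrite mulrCA lambdaE mulrC ler_pM2l//.
  apply: poisson_mean_le => //; first exact: (bounded_A_seq tPhi Ia Ib gab).
    exact: (bounded_B_seq tPhi Ia Ib gab).
  move=> n; apply: (A_transform_le_B tPhi); rewrite ?subrKC;
    exact: (I_itv _ _ Ia Ib).
- apply: (B_entropic_inequality_bounded tangent_convex_sqr) => // a b g _ _ gab.
  pose sqr (u : R) := u ^+ 2.
  have AE u v : A_transform sqr u v = v ^+ 2.
    by rewrite /A_transform derive1_sqr /sqr; lra.
  have tanA u v : setT u -> setT (u + v) -> exists a b, forall u' v',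
      setT u' -> setT (u' + v') ->
      A_transform sqr u v + a * (u' - u) + b * (v' - v) <= A_transform sqr u' v'.
    (* The gradient of [v ^+ 2] at [(u, v)]. *)
    move=> _ _; exists 0, (2 * v) => u' v' _ _; rewrite !AE.
    by have := sqr_ge0 (v' - v); lra.
  have := poisson_A_entropic_inequality tangent_convex_sqr tanA Logic.I Logic.I
    gab rho0.
  have mu2 : 0 <= 2 * mu by rewrite mulr_ge0// ltW.
  move/(ler_wpM2l mu2) => /le_trans; apply.
  (* Here [B = 2 A] exactly, whence the constant 2 in place of 1. *)
  have -> : (fun n => B_transform sqr (g n) (discrete_gradient g n)) =
      (fun n => 2 * A_transform sqr (g n) (discrete_gradient g n)).
    by apply/funext => n; rewrite AE /B_transform !derive1_sqr; lra.
  rewrite poisson_meanZ; last first.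
    exact: (bounded_A_seq tangent_convex_sqr Logic.I Logic.I gab).
  set X := poisson_mean _ _.
  rewrite (_ : 2 * mu * _ = mu * (lambda / mu) * (2 * X)); last by lra.
  by rewrite lambdaE.
Qed.
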